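(* Let $L\to\widetilde L$ be a projective change of Finsler structures on $M$ with projective factor $\lambda$, i.e. $\widetilde G=G-2\lambda\,\mathcal C$. Define, for $\pi$-vector fields $\overline X,\overline Y$, $$\alpha(\overline X)=d_J\lambda(\beta\overline X),\quad Q(\overline X)=\beta\overline X\cdot\lambda-\lambda\,\alpha(\overline X),\quad \varepsilon(\overline X,\overline Y)=(D^\circ_{\gamma\overline X}Q)(\overline Y)-(D^\circ_{\gamma\overline Y}Q)(\overline X).$$ Then the $h$-curvature tensors $R^\circ,\widetilde R^\circ$ and the $hv$-curvature tensors $P^\circ,\widetilde P^\circ$ of the Berwald connections satisfy, for all $\pi$-vector fields $\overline X,\overline Y,\overline Z$: (a) $\widetilde R^{\circ}(\overline X,\overline Y)\overline Z=R^\circ(\overline X,\overline Y)\overline Z+(D^\circ_{\gamma\overline Z}Q)(\overline Y)\,\overline X-(D^\circ_{\gamma\overline Z}Q)(\overline X)\,\overline Y+\varepsilon(\overline X,\overline Y)\,\overline Z+(D^\circ_{\gamma\overline Z}\varepsilon)(\overline X,\overline Y)\,\overline\eta$; (b) $\widetilde P^{\circ}(\overline X,\overline Y)\overline Z=P^\circ(\overline X,\overline Y)\overline Z+\mathfrak S_{\overline X,\overline Y,\overline Z}\{(\stackrel{2}{D^\circ}\alpha)(\overline Y,\overline Z)\,\overline X\}+(\stackrel{2}{D^\circ}\stackrel{2}{D^\circ}\alpha)(\overline X,\overline Y,\overline Z)\,\overline\eta$, where $\mathfrak S_{\overline X,\overline Y,\overline Z}$ denotes the cyclic sum over $\overline X,\overline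 Y,\overline Z$.
   Context: $M$ is a real paracompact $C^\infty$ manifold of dimension $n$; $\pi:\mathcal TM\to M$ is the bundle of nonzero tangent vectors; $\pi^{-1}(TM)\to\mathcal TM$ is the pullback of $TM$ by $\pi$. Sections of $\pi^{-1}(TM)$ are called $\pi$-vector fields and written $\overline X$; tensor fields on $\pi^{-1}(TM)$ are called $\pi$-tensor fields (scalar-valued covariant ones: $\pi$-forms). $\overline\eta$ is the $\pi$-vector field $\overline\eta(u)=(u,u)$. There is an exact sequence $0\to\pi^{-1}(TM)\xrightarrow{\gamma}T(\mathcal TM)\xrightarrow{\rho}\pi^{-1}(TM)\to0$, where $\gamma$ is the vertical lift $\gamma(u,w)=\frac{d}{dt}\big|_{t=0}(u+tw)$ and $\rho$ sends $X\in T_u(\mathcal TM)$ to $(u,d\pi(X))$. Put $J:=\gamma\circ\rho$ and $\mathcal C:=\gamma\circ\overline\eta$. For a function $f$, $d_Jf(X)=(JX)\cdot f$. For a Finsler manifold $(M,L)$ with $E=\frac12L^2$: the canonical spray $G$ is the vector field with $i_G\,dd_JE=-dE$; the Barthel connection is $\Gamma=[J,G]$, i.e. $\Gamma(X)=[JX,G]-J[X,G]$; $h=\frac12(I+\Gamma)$, $v=\frac12(I-\Gamma)$. The horizontal map $\beta:\pi^{-1}(TM)\to T(\mathcal TM)$ sends $\overline X$ to the unique vector in the image of $h$ with $\rho(\beta\overline X)=\overline X$; $K:T(\mathcal TM)\to\pi^{-1}(TM)$ is determined by $\gamma\circ K=v$. The Berwald connection $D^\circ$ is the linear connection on $\pi^{-1}(TM)$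 with $D^\circ_{\gamma\overline X}\overline Y=\rho[\gamma\overline X,\beta\overline Y]$ and $D^\circ_{\beta\overline X}\overline Y=K[\beta\overline X,\gamma\overline Y]$. For a $\pi$-tensor field $A$, $(\stackrel{2}{D^\circ}A)(\overline X,\overline Y,\dots):=(D^\circ_{\gamma\overline X}A)(\overline Y,\dots)$, and $\stackrel{2}{D^\circ}\stackrel{2}{D^\circ}A$ means $\stackrel{2}{D^\circ}$ applied to $\stackrel{2}{D^\circ}A$, the outer differentiation direction being the first argument. Curvature: $\mathbf K(X,Y)\overline Z=-D^\circ_XD^\circ_Y\overline Z+D^\circ_YD^\circ_X\overline Z+D^\circ_{[X,Y]}\overline Z$; $R^\circ(\overline X,\overline Y)\overline Z=\mathbf K(\beta\overline X,\beta\overline Y)\overline Z$ and $P^\circ(\overline X,\overline Y)\overline Z=\mathbf K(\beta\overline X,\gamma\overline Y)\overline Z$. Projective change: a change $L\to\widetilde L$ of Finsler structures on $M$ whose canonical sprays satisfy $\widetilde G=G-2\lambda\mathcal C$ for a function $\lambda$ on $TM$ (smooth on $\mathcal TM$) positively homogeneous of degree 1 in $y$. Tilded objects are those of $(M,\widetilde L)$. *)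

(* Defs.v *)
From HB Require Import structures.
From mathcomp Require Import all_boot all_order all_algebra.
From mathcomp Require Import all_classical all_reals all_analysis.

Set Implicit Arguments.
Unset Strict Implicit.
Unset Printing Implicit Defensive.

Import Order.TTheory GRing.Theory Num.Theory.
Import numFieldNormedType.Exports.

Local Open Scope classical_set_scope.
Local Open Scope ring_scope.

Section SmoothEuclidean.
Context {R : realType} {d : nat}.

Definition partial (i : 'I_d) (f : 'rV[R]_d -> R) : 'rV[R]_d -> R :=
  fun x => 'D_(delta_mx 0 i) f x.

Fixpoint Ck (k : nat) (U : set 'rV[R]_d) (f : 'rV[R]_d -> R) : Prop :=
  (forall x, U x -> {for x, continuous f}) /\
  (if k is k'.+1 then
     forall i, (forall x, U x -> derivable f x (delta_mx 0 i)) /\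
               Ck k' U (partial i f)
   else True).

Definition smooth_on (U : set 'rV[R]_d) (f : 'rV[R]_d -> R) : Prop :=
  forall k, Ck k U f.

End SmoothEuclidean.

Definition paracompact (T : topologicalType) : Prop :=
  forall C : set (set T),
    (forall A, C A -> open A) -> \bigcup_(A in C) A = setT ->
  exists D : set (set T),
    [/\ forall B, D B -> open B,
        \bigcup_(B in D) B = setT,
        forall B, D B -> exists2 A, C A & B `<=` A &
        forall x : T, exists2 W, nbhs x W &
          finite_set [set B | D B /\ B `&` W !=set0]].

(* The atlas need not be maximal: it is only used through the smooth structure
   it generates.  [par c] inverts the chart [crd c] on its domain. *)
Record manifold (R : realType) (n : nat) := Manifold {
  carrier :> topologicalType;
  carrier_hausdorff : hausdorff_space carrier;
  carrier_paracompact : paracompact carrier;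
  chart : Type;
  dom : chart -> set carrier;
  crd : chart -> carrier -> 'rV[R]_n;
  par : chart -> 'rV[R]_n -> carrier;
  dom_open : forall c, open (dom c);
  dom_cover : \bigcup_c dom c = setT;
  crd_open : forall c, open (crd c @` dom c);
  crdK : forall c p, dom c p -> par c (crd c p) = p;
  crd_continuous : forall c p, dom c p -> {for p, continuous (crd c)};
  par_continuous : forall c x, (crd c @` dom c) x -> {for x, continuous (par c)};
  transition_smooth : forall c c' j,
    smooth_on (crd c @` (dom c `&` dom c')) (fun x => crd c' (par c x) 0 j)
}.

(* A smooth structure on a type [T] is given by [S : T -> set (T -> R)], where
   [S p f] reads "f is C^oo in some neighbourhood of p".  A tangent vector at p
   is a derivation at p of the algebra of these functions (such a derivation
   only depends on germs).  For tangent vectors to be equal exactly when they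
   agree on S p, they are given the value 0 outside S p. *)
Section Derivations.
Context {R : realType} {T : Type} (S : T -> set (T -> R)).

Definition operator := (T -> R) -> R.

Definition tangent (p : T) (D : operator) : Prop :=
  [/\ forall (a : R) f g, S p f -> S p g ->
        D (fun q => a * f q + g q) = a * D f + D g,
      forall f g, S p f -> S p g ->
        D (fun q => f q * g q) = f p * D g + g p * D f &
      forall f, ~ S p f -> D f = 0].

Definition restrict_op (p : T) (D : operator) : operator :=
  fun f => if `[< S p f >] then D f else 0.

Definition smooth (f : T -> R) : Prop := forall p, S p f.

Definition field := T -> operator.

Definition act (X : field) (f : T -> R) : T -> R := fun p => X p f.

Definition vector_field (X : field) : Prop :=
  (forall p, tangent p (X p)) /\ (forall p f, S p f -> S p (act X f)).

Definition bracket (X Y : field) : field :=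
  fun p => restrict_op p (fun f => X p (act Y f) - Y p (act X f)).

End Derivations.

Arguments operator : clear implicits.
Arguments field : clear implicits.

Definition scale_field {R : realType} {T B : Type}
  (f : T -> R) (X : T -> operator R B) : T -> operator R B :=
  fun u => f u *: X u.

Notation "f '*v' X" := (scale_field f X) (at level 40, left associativity).

(* The parametrizations [phi c] take values in [option T] because [T] may be a
   subtype; only their values on the open sets [U c] matter, where they are
   [Some _], so that the default value 0 below is never used. *)
Definition smooth_near {R : realType} {d : nat} {I T : Type}
  (U : I -> set 'rV[R]_d) (phi : I -> 'rV[R]_d -> option T) (p : T) :
  set (T -> R) :=
  [set f : T -> R | forall c z, U c z -> phi c z = Some p ->
     exists V : set 'rV[R]_d,
       [/\ open V, V z, V `<=` U c & smooth_on V (fun w => oapp f 0 (phi c w))]].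

Section TangentBundle.
Context {R : realType} {n : nat} (M : manifold R n).

Definition cod (c : chart M) : set 'rV[R]_n := crd c @` dom c.

Definition smM : M -> set (M -> R) :=
  smooth_near cod (fun c x => Some (par c x)).

Definition TM := {u : M * operator R M | `[< tangent smM u.1 u.2 >]}.

Definition slit := {u : TM | (val u).2 != 0}.

Definition base (u : slit) : M := (val (val u)).1.
Definition vec (u : slit) : operator R M := (val (val u)).2.

Definition mkTM (u : M * operator R M) : option TM := insub u.
Definition mkslit (u : M * operator R M) : option slit := obind insub (mkTM u).

(* The tangent vector sum_j y^j d/dx^j at the point of coordinates x, where
   z = (x, y). *)
Definition coord_vec (c : chart M) (z : 'rV[R]_(n + n)) : M * operator R M :=
  (par c (lsubmx z),
   restrict_op smM (par c (lsubmx z)) (fun g =>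
     \sum_j rsubmx z 0 j * partial j (g \o par c) (lsubmx z))).

Definition slit_cod (c : chart M) : set 'rV[R]_(n + n) :=
  [set z | cod c (lsubmx z) /\ rsubmx z != 0].

Definition smT : slit -> set (slit -> R) :=
  smooth_near slit_cod (fun c z => mkslit (coord_vec c z)).

Definition continuousTM (f : TM -> R) : Prop :=
  forall c z, cod c (lsubmx z) ->
    {for z, continuous (fun w => oapp f 0 (mkTM (coord_vec c w)))}.

Definition homogeneous1 (f : TM -> R) : Prop :=
  forall (u u' : TM) (t : R), 0 < t ->
    val u' = ((val u).1, t *: (val u).2) -> f u' = t * f u.

Definition restr (f : TM -> R) : slit -> R := fun u => f (val u).

Definition pifield := slit -> operator R M.

Definition pi_vector_field (X : pifield) : Prop :=
  (forall u, tangent smM (base u) (X u)) /\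
  (forall u g, smM (base u) g -> smT u (fun u' => X u' g)).

Definition eta : pifield := vec.

(* The velocity at t = 0 of the curve u + t w with w = X u, which consists of
   nonzero vectors for small t. *)
Definition gamma (X : pifield) : field R slit := fun u =>
  restrict_op smT u (fun f =>
    derive1 (fun t : R => oapp f 0 (mkslit (base u, vec u + t *: X u))) 0).

Definition rho (X : field R slit) : pifield := fun u =>
  restrict_op smM (base u) (fun g => X u (g \o base)).

Definition J (X : field R slit) : field R slit := gamma (rho X).

Definition liouville : field R slit := gamma eta.

Definition dJ (f : slit -> R) (X : field R slit) : slit -> R := act (J X) f.

Definition ddJ (f : slit -> R) (X Y : field R slit) : slit -> R := fun u =>
  act X (dJ f Y) u - act Y (dJ f X) u - dJ f (bracket smT X Y) u.

Definition energy (L : TM -> R) : slit -> R := fun u => 2^-1 * (restr L u) ^+ 2.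

(* The last clause is the nondegeneracy of the 2-form dd_J E. *)
Definition finsler (L : TM -> R) : Prop :=
  [/\ continuousTM L,
      smooth smT (restr L),
      forall u, 0 < restr L u,
      homogeneous1 L &
      forall X, vector_field smT X -> forall u,
        (forall Y, vector_field smT Y -> ddJ (energy L) X Y u = 0) -> X u = 0].

Definition canonical_spray (L : TM -> R) (G : field R slit) : Prop :=
  vector_field smT G /\
  forall Y, vector_field smT Y ->
    ddJ (energy L) G Y = (fun u => - act Y (energy L) u).

Definition barthel (G X : field R slit) : field R slit :=
  bracket smT (J X) G - J (bracket smT X G).

Definition hproj (G X : field R slit) : field R slit :=
  fun u => 2^-1 *: (X u + barthel G X u).

Definition vproj (G X : field R slit) : field R slit :=
  fun u => 2^-1 *: (X u - barthel G X u).

Definition horizontal_map (G : field R slit) (beta : pifield -> field R slit) :=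
  forall X, pi_vector_field X ->
    [/\ vector_field smT (beta X),
        exists2 Z, vector_field smT Z & beta X = hproj G Z &
        rho (beta X) = X].

Definition connector (G : field R slit) (K : field R slit -> pifield) :=
  forall X, vector_field smT X ->
    pi_vector_field (K X) /\ gamma (K X) = vproj G X.

Definition linear_connection (D : field R slit -> pifield -> pifield) : Prop :=
  [/\ forall X Y, vector_field smT X -> pi_vector_field Y ->
        pi_vector_field (D X Y),
      forall f X X' Y, smooth smT f -> vector_field smT X ->
        vector_field smT X' -> pi_vector_field Y ->
        D (f *v X + X') Y = f *v D X Y + D X' Y,
      forall X Y Y', vector_field smT X -> pi_vector_field Y ->
        pi_vector_field Y' -> D X (Y + Y') = D X Y + D X Y' &
      forall f X Y, smooth smT f -> vector_field smT X -> pi_vector_field Y ->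
        D X (f *v Y) = act X f *v Y + f *v D X Y].

Definition berwald_connection (beta : pifield -> field R slit)
    (K : field R slit -> pifield) (D : field R slit -> pifield -> pifield) :=
  linear_connection D /\
  forall X Y, pi_vector_field X -> pi_vector_field Y ->
    D (gamma X) Y = rho (bracket smT (gamma X) (beta Y)) /\
    D (beta X) Y = K (bracket smT (beta X) (gamma Y)).

(* The objects canonically attached to (M, L); each one is uniquely determined
   by L on vector fields and pi-vector fields. *)
Record finsler_objects (L : TM -> R) := FinslerObjects {
  spray : field R slit;
  sprayP : canonical_spray L spray;
  hmap : pifield -> field R slit;
  hmapP : horizontal_map spray hmap;
  kmap : field R slit -> pifield;
  kmapP : connector spray kmap;
  berwald : field R slit -> pifield -> pifield;
  berwaldP : berwald_connection hmap kmap berwald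
}.

Section Objects.
Context {L : TM -> R} (F : finsler_objects L).
Local Notation D := (berwald F).
Local Notation beta := (hmap F).

Definition curvature (X Y : field R slit) (Z : pifield) : pifield :=
  - D X (D Y Z) + D Y (D X Z) + D (bracket smT X Y) Z.

Definition hcurv (X Y Z : pifield) : pifield := curvature (beta X) (beta Y) Z.
Definition hvcurv (X Y Z : pifield) : pifield := curvature (beta X) (gamma Y) Z.

(* The direction of differentiation is the first argument [X]. *)
Definition D2form1 (A : pifield -> slit -> R) (X Y : pifield) : slit -> R :=
  fun u => act (gamma X) (A Y) u - A (D (gamma X) Y) u.

Definition D2form2 (A : pifield -> pifield -> slit -> R) (X Y Z : pifield) :
    slit -> R :=
  fun u => act (gamma X) (A Y Z) u - A (D (gamma X) Y) Z u
           - A Y (D (gamma X) Z) u.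

Variable lambda : TM -> R.

Definition alpha (X : pifield) : slit -> R := dJ (restr lambda) (beta X).

Definition Qform (X : pifield) : slit -> R :=
  fun u => act (beta X) (restr lambda) u - restr lambda u * alpha X u.

Definition epsilon (X Y : pifield) : slit -> R :=
  fun u => D2form1 Qform X Y u - D2form1 Qform Y X u.

End Objects.

Definition projective_change (L L' : TM -> R)
    (F : finsler_objects L) (F' : finsler_objects L') (lambda : TM -> R) : Prop :=
  [/\ smooth smT (restr lambda), homogeneous1 lambda &
      spray F' = spray F - (fun u => 2 * restr lambda u) *v liouville].

End TangentBundle.

Arguments eta {R n M}.
Arguments liouville {R n M}.

(* Main.v *)
(* Vertical and horizontal vector fields are recognized by their values on two
   kinds of test functions on the slit tangent bundle: g o pi and the fibrewise
   linear function u |-> u(g), for g smooth near the base point.  With these,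
   D_{gamma X} Y is componentwise vertical differentiation, and
     K A (g) = A(u(g)) - 1/2 (J A)(G(u(g))),
   so the whole Berwald calculus is expressed by brackets.  A projective change
   gives, for T X = alpha(X) eta + lambda X,
     beta' X = beta X - gamma (T X),   K' A = K A + T (rho A),
     D'_A Y = D_A Y + (D_{gamma Y} T)(rho A).
   By the Jacobi identity R(X, Y) Z = (D_{gamma Z} Om)(X, Y) for the torsion
   Om(X, Y) = K [beta X, beta Y], and the formulas above yield
     Om'(X, Y) = Om(X, Y) + eps(X, Y) eta - Q(X) Y + Q(Y) X,
   whose vertical derivative is (a).  Since vertical curvature vanishes, P' - P is
   the vertical derivative of D' - D, which is (b).
   The identities J G = C and [C, G] = G used on the way follow from the
   homogeneity of E and the nondegeneracy of dd_J E. *)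
Require Import Defs.
From mathcomp Require Import all_boot all_order all_algebra.
From mathcomp Require Import all_classical all_reals all_analysis.
From mathcomp Require Import ring lra.

Set Implicit Arguments.
Unset Strict Implicit.
Unset Printing Implicit Defensive.

Import Order.TTheory GRing.Theory Num.Theory.
Import numFieldNormedType.Exports.

Local Open Scope classical_set_scope.
Local Open Scope ring_scope.

(** * Differential calculus on row vectors *)

(** Tangent vectors are abstract derivations, while the charts of the slit tangent bundle only reach
    combinations of the d/dx^j. That every derivation has this form is classically a matter of
    Hadamard's lemma and cut-off functions. This is bypassed: the covering property is carried as a
    hypothesis [cov] through the theory of the vertical lift, and is then forced by the existence of
    a horizontal map ([slit_cover]). Locality of derivations is obtained from indicator functions,
    which are admissible because smoothness at a point constrains only germs. The tensor T is the
    vertical derivative of lambda eta, that is T X = D_{gamma X} (lambda eta): the factor 2 in the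
    change of spray is absorbed by the 1/2 in the formula for K. Hence D' - D is the second vertical
    derivative of lambda eta, and P' - P the third; this explains both the symmetry of (b) and the
    shape of its terms, D_{gamma X} eta = X producing the terms without eta. *)

Section Calculus.
Context {R : realType}.

(** Bounding [c] in absolute value serves increments [a] of either sign, as they occur in a step
    along one coordinate; the two cases apply the mean value theorem on [0, a] and on [a, 0]. *)
Lemma mean_value_signed (g dg : R -> R) (a : R) :
  (forall s : R, `|s| <= `|a| -> is_derive s 1 g (dg s)) ->
  exists2 c, `|c| <= `|a| & g a - g 0 = a * dg c.
Proof.
move=> dgP.
have MV b c : b <= c -> (forall s, s \in `[b, c]%R -> `|s| <= `|a|) ->
    exists2 s, `|s| <= `|a| & g c - g b = dg s * (c - b).
  move=> bc sP.
  have gc : {within `[b, c], continuous g}.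
    by apply: derivable_within_continuous => s /sP /dgP [].
  have [s|s sbc gE] := @MVT_segment R g dg b c bc _ gc.
    by move=> /subset_itv_oo_cc /sP /dgP.
  by exists s => //; exact: sP.
have [a0|a0] := leP 0 a.
  have [s|s sa ->] := MV 0 a a0; last by exists s; rewrite // subr0 mulrC.
  by rewrite in_itv /= => /andP[s0 sa]; rewrite !ger0_norm.
have [s|s sa gE] := MV a 0 (ltW a0).
  by rewrite in_itv /= => /andP[s0 sa]; rewrite !ler0_norm ?lerN2 // ltW.
by exists s => //; rewrite -opprB gE sub0r mulrN opprK mulrC.
Qed.

Lemma derive_along_line (d : nat) (f : 'rV[R]_d -> R) (p v : 'rV[R]_d) (s : R) :
  derivable f (p + s *: v) v ->
  is_derive s 1 (fun t : R => f (p + t *: v)) ('D_v f (p + s *: v)).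
Proof.
have E : (fun h : R => h^-1 *: (f (h *: v + (p + s *: v)) - f (p + s *: v))) =
         (fun h : R => h^-1 *: (f (p + (h *: (1 : R) + s) *: v) - f (p + s *: v))).
  by apply/funext => h; rewrite [_%:A]mulr1 scalerDl addrCA.
by move=> df; split; rewrite /derivable /derive /= -?E.
Qed.

(** For k from 0 to d, the points [y + head_row k h] are the vertices of a path from y to [y + h]
    that changes one coordinate at a time. *)
Definition head_row (d k : nat) (h : 'rV[R]_d) : 'rV[R]_d :=
  \row_j (if (j < k)%N then h 0 j else 0).

(* Telescoping along the coordinates and the mean value theorem on each step. *)
Lemma increment_partials (d : nat) (f : 'rV[R]_d -> R) (y : 'rV[R]_d) (e : R)
    (h : 'rV[R]_d) :
  (forall j x, ball y e x -> derivable f x (delta_mx 0 j)) -> ball y e (y + h) ->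
  exists2 xi : 'I_d -> 'rV[R]_d, (forall k j, `|xi k 0 j - y 0 j| <= `|h 0 j|) &
    f (y + h) - f y = \sum_k h 0 k * partial k f (xi k).
Proof.
move=> df [e0 bh].
have near_y (x : 'rV[R]_d) : (forall j, `|x 0 j - y 0 j| <= `|h 0 j|) -> ball y e x.
  move=> xP; split=> // i j; rewrite (ord1 i) /ball /= distrC.
  apply: le_lt_trans (xP j) _; have := bh 0 j.
  by rewrite mxE /ball /= opprD addrA subrr sub0r normrN.
pose p k := y + head_row k h.
have stepP (k : 'I_d) : exists xi : 'rV[R]_d,
    (forall j, `|xi 0 j - y 0 j| <= `|h 0 j|) /\
    f (p k.+1) - f (p k) = h 0 k * partial k f xi.
  have pS : p k.+1 = p k + h 0 k *: delta_mx 0 k.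
    rewrite /p -addrA; congr (_ + _); apply/rowP => j; rewrite !mxE eqxx /=.
    rewrite ltnS leq_eqVlt; have [->|jk] := eqVneq j k.
      by rewrite eqxx ltnn /= mulr1 add0r.
    by rewrite val_eqE (negbTE jk) /= mulr0 addr0.
  have dist_p (s : R) j : `|s| <= `|h 0 k| ->
      `|(p k + s *: delta_mx 0 k) 0 j - y 0 j| <= `|h 0 j|.
    move=> sh; rewrite !mxE eqxx /= addrC addrA addrA addNr add0r.
    have [->|jk] := eqVneq j k; first by rewrite ltnn add0r mulr1.
    by rewrite mulr0 addr0; case: ifP => // _; rewrite normr0.
  have [s|c ch E] := @mean_value_signed (fun t => f (p k + t *: delta_mx 0 k))
     (fun t => partial k f (p k + t *: delta_mx 0 k)) (h 0 k).
    move=> sh; apply: derive_along_line; apply: df; apply: near_y => j.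
    exact: dist_p.
  exists (p k + c *: delta_mx 0 k); split=> [j|]; first exact: dist_p.
  by rewrite pS -E scale0r addr0.
have [xi xiP] := choice stepP; exists xi => [k|]; first by case: (xiP k).
have -> : y + h = p d by rewrite /p; congr (_ + _); apply/rowP => j; rewrite mxE ltn_ord.
have -> : y = p 0%N.
  by rewrite /p -[LHS]addr0; congr (_ + _); apply/rowP => j; rewrite !mxE.
rewrite -(telescope_sumr (fun k => f (p k))) // big_mkord.
by apply: eq_bigr => k _; case: (xiP k).
Qed.

End Calculus.

(** * Chain rule from continuous partial derivatives *)

Section Chain.
Context {R : realType}.

Lemma cvg_bigsum (I T : Type) (F : set_system T) {FF : Filter F} (r : seq I)
    (f : I -> T -> R) (l : I -> R) :
  (forall i, f i x @[x --> F] --> l i) ->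
  (\sum_(i <- r) f i x) @[x --> F] --> \sum_(i <- r) l i.
Proof.
move=> fl; elim: r => [|i r IH].
  by under eq_fun do rewrite big_nil; rewrite big_nil; exact: cvg_cst.
by under eq_fun do rewrite big_cons; rewrite big_cons; exact: cvgD.
Qed.

Lemma cvg_row (d : nat) (T : Type) (F : set_system T) {FF : Filter F}
    (f : T -> 'rV[R]_d) (l : 'rV[R]_d) :
  (forall j, f x 0 j @[x --> F] --> l 0 j) -> f x @[x --> F] --> l.
Proof.
move=> fl; apply/cvg_ballP => e e0; near=> x; split=> // i j.
by rewrite (ord1 i); move: j; near: x; apply: filter_forall => j; have /cvg_ballP := fl j; apply.
Unshelve. all: by end_near. Qed.

Lemma continuous_row (d : nat) (V : topologicalType) (f : V -> 'rV[R]_d) (x : V) :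
  (forall j, {for x, continuous (fun z => f z 0 j)}) -> {for x, continuous f}.
Proof. exact: cvg_row. Qed.

Lemma is_derive_cvg (V : normedModType R) (f : V -> R) (x v : V) (l : R) :
  h^-1 *: (f (h *: v + x) - f x) @[h --> 0^'] --> l -> is_derive x v f l.
Proof.
by move=> fl; split; [apply/cvg_ex; exists l | exact: cvg_lim].
Qed.

Lemma cvg_is_derive (V : normedModType R) (f : V -> R) (x v : V) (l : R) :
  is_derive x v f l -> h^-1 *: (f (h *: v + x) - f x) @[h --> 0^'] --> l.
Proof. by case=> df <-; exact: df. Qed.

Lemma cvg_to_line (V : normedModType R) (x v : V) :
  h *: v + x @[h --> (0 : R)^'] --> x.
Proof.
apply: (@cvg_trans _ ((fun h : R => h *: v + x) @ (0 : R))).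
  exact: cvg_app (cvg_within _).
have -> : nbhs x = nbhs (0 *: v + x) by rewrite scale0r add0r.
apply: (@cvgD _ _ _ (nbhs (0 : R)) _ (fun h => h *: v) (fun=> x)); last exact: cvg_cst.
exact: cvgZr_tmp.
Qed.

(** Total differentiability of f is never invoked. [increment_partials] writes the increment of f as
    a sum of coordinate increments times partials at intermediate points; these points tend to
    [phi x], where the partials are continuous, so the difference quotient converges termwise. *)
Lemma is_derive_chain (d : nat) (V : normedModType R) (f : 'rV[R]_d -> R)
    (phi : V -> 'rV[R]_d) (x v : V) (dphi : 'I_d -> R) :
  (\forall y \near phi x, forall j, derivable f y (delta_mx 0 j)) ->
  (forall j, {for phi x, continuous (partial j f)}) ->
  {for x, continuous phi} ->
  (forall j, is_derive x v (fun z => phi z 0 j) (dphi j)) ->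
  is_derive x v (f \o phi) (\sum_j dphi j * partial j f (phi x)).
Proof.
move=> /nbhs_ballP[r r0 df] cf cphi dphiP; set y := phi x in df cf *.
(* The intermediate points are chosen for all increments at once, so that they become functions of h
   with a limit; outside the ball the default [y] keeps the distance bound true. *)
have /choice[xi xiP] : forall h : 'rV[R]_d, exists xi : 'I_d -> 'rV[R]_d,
    (forall k j, `|xi k 0 j - y 0 j| <= `|h 0 j|) /\
    (ball y r (y + h) -> f (y + h) - f y = \sum_k h 0 k * partial k f (xi k)).
  move=> h; have [yh|nyh] := pselect (ball y r (y + h)); last first.
    by exists (fun=> y); split=> // k j; rewrite subrr normr0.
  have [||xi xiP E] := @increment_partials R d f y r h; last by exists xi.
    by move=> j z /df.
  exact: yh.
apply: is_derive_cvg.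
have cphil : phi (h *: v + x) @[h --> 0^'] --> y.
  exact: cvg_comp (@cvg_to_line _ x v) cphi.
pose Dl h := phi (h *: v + x) - y.
have cD j : Dl h 0 j @[h --> (0:R)^'] --> (0 : R).
  have c0 : Dl h @[h --> (0:R)^'] --> (0 : 'rV[R]_d).
    have -> : nbhs (0 : 'rV[R]_d) = nbhs (y - y) by rewrite subrr.
    by apply: cvgB => //; exact: cvg_cst.
  have -> : nbhs (0 : R) = nbhs ((0 : 'rV[R]_d) 0 j) by rewrite mxE.
  exact: (cvg_comp _ (fun M : 'rV[R]_d => M 0 j) c0 (@coord_continuous R 1 d 0 j 0)).
have cxi k : xi (Dl h) k @[h --> (0 : R)^'] --> y.
  apply: cvg_row => j; apply/cvgrPdist_le => e e0.
  have /cvgrPdist_le /(_ e e0) := cD j; apply: filterS => h.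
  rewrite sub0r normrN distrC => le; apply: le_trans le; exact: (xiP _).1.
have cpart k : partial k f (xi (Dl h) k) @[h --> (0 : R)^'] --> partial k f y.
  exact: cvg_comp (cxi k) (cf k).
apply: (@cvg_trans _ ((fun h : R => \sum_k (h^-1 *: (phi (h *: v + x) 0 k - phi x 0 k)) *
    partial k f (xi (Dl h) k)) @ (0 : R)^')); last first.
  by apply: cvg_bigsum => k; apply: cvgM => //; exact: cvg_is_derive (dphiP k).
apply: near_eq_cvg; near=> h.
have -> : (f \o phi) (h *: v + x) = f (y + Dl h) by rewrite /= /Dl [y + _]addrC subrK.
rewrite (xiP (Dl h)).2; last first.
  have -> : y + Dl h = phi (h *: v + x) by rewrite /Dl [y + _]addrC subrK.
  by near: h; exact: (cphil _ (nbhsx_ballx y r r0)).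
rewrite scaler_sumr; apply: eq_bigr => k _.
by rewrite -[RHS]/(h^-1 * (Dl h 0 k * partial k f (xi (Dl h) k))) mulrA /Dl !mxE.
Unshelve. all: by end_near. Qed.

End Chain.

(** * The classes C^k and their closure properties *)

Section Smoothness.
Context {R : realType}.
Implicit Types d k : nat.

Lemma Ck_continuous d k (U : set 'rV[R]_d) f x :
  Ck k U f -> U x -> {for x, continuous f}.
Proof. by case: k => [|k] [cf _]; exact: cf. Qed.

Lemma Ck_derivable d k (U : set 'rV[R]_d) f x i :
  Ck k.+1 U f -> U x -> derivable f x (delta_mx 0 i).
Proof. by move=> [_ df]; exact: (df i).1. Qed.

Lemma CkW d k (U : set 'rV[R]_d) f : Ck k.+1 U f -> Ck k U f.
Proof.
elim: k f => [|k IH] f [cf df]; split=> // i.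
by have [di /IH] := df i.
Qed.

Lemma Ck_subset d k (U V : set 'rV[R]_d) f : V `<=` U -> Ck k U f -> Ck k V f.
Proof.
move=> VU; elim: k f => [|k IH] f [cf df]; split=> //; try by move=> x /VU/cf.
by move=> i; have [di /IH] := df i; split=> // x /VU/di.
Qed.

Lemma near_eq_continuous (T : topologicalType) (f g : T -> R) (x : T) :
  (\forall y \near x, f y = g y) -> {for x, continuous f} -> {for x, continuous g}.
Proof.
move=> fg cf; have fgx : f x = g x by exact: nbhs_singleton fg.
suff : g y @[y --> x] --> g x by [].
by rewrite -fgx; apply: cvg_trans cf; exact: near_eq_cvg.
Qed.

(** A partial derivative sees only the values near the point, hence the openness of U. The sum,
    product and chain formulas for [partial] are known only on U, and this lemma lets them stand for
    the actual partial derivatives in each induction on k. *)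
Lemma Ck_eq d k (U : set 'rV[R]_d) f g :
  open U -> (forall x, U x -> f x = g x) -> Ck k U f -> Ck k U g.
Proof.
move=> oU; have near_eq f' g' x : (forall x, U x -> f' x = g' x) -> U x ->
    \forall y \near x, f' y = g' y.
  by move=> fg Ux; near=> y; apply: fg; near: y; exact: open_nbhs_nbhs.
elim: k f g => [|k IH] f g fg [cf df].
  by split=> // x Ux; apply: near_eq_continuous (cf x Ux); exact: near_eq.
split=> [x Ux|i]; first by apply: near_eq_continuous (cf x Ux); exact: near_eq.
have [di ck] := df i; split=> [x Ux|].
  by apply: near_eq_derivable (di x Ux); exact: near_eq.
by apply: IH ck => x Ux; apply: near_eq_derive; exact: near_eq.
Unshelve. all: by end_near. Qed.

Lemma Ck_cst d k (U : set 'rV[R]_d) (c : R) : Ck k U (fun=> c).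
Proof.
elim: k c => [|k IH] c; split=> //; try by move=> x _; exact: cst_continuous.
move=> i; split=> [x _|]; first exact: derivable_cst.
rewrite (_ : partial i _ = fun=> 0) //; apply/funext => x.
exact: derive_cst.
Qed.

Lemma is_derive_coord d (i j : 'I_d) (x : 'rV[R]_d) :
  is_derive x (delta_mx 0 i) (fun y : 'rV[R]_d => y 0 j) (i == j)%:R.
Proof.
apply: is_derive_cvg.
apply: (@cvg_trans _ ((fun=> (i == j)%:R) @ (0 : R)^')); last exact: cvg_cst.
apply: near_eq_cvg.
near=> h; rewrite !mxE eqxx addrK /= eq_sym -[RHS]/(h^-1 * (h * _)) mulKf //.
by near: h; exact: nbhs_dnbhs_neq.
Unshelve. all: by end_near. Qed.

Lemma Ck_coord d k (U : set 'rV[R]_d) (j : 'I_d) : Ck k U (fun x => x 0 j).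
Proof.
have dj i x := is_derive_coord i j x.
case: k => [|k]; split=> //; try by move=> x _; exact: coord_continuous.
move=> i; split=> [x _|]; first by have [] := dj i x.
rewrite (_ : partial i _ = fun=> (i == j)%:R); first exact: Ck_cst.
by apply/funext => x; have [_] := dj i x.
Qed.

Lemma CkD d k (U : set 'rV[R]_d) f g :
  open U -> Ck k U f -> Ck k U g -> Ck k U (fun x => f x + g x).
Proof.
move=> oU; elim: k f g => [|k IH] f g [cf df] [cg dg]; split=> //;
  try by move=> x Ux; apply: continuousD; [exact: cf | exact: cg].
move=> i; have [dfi ckf] := df i; have [dgi ckg] := dg i.
split=> [x Ux|]; first by apply: derivableD; [exact: dfi|exact: dgi].
apply: Ck_eq (IH _ _ ckf ckg) => // x Ux; rewrite /partial.
by rewrite (deriveD (dfi x Ux) (dgi x Ux)).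
Qed.

Lemma CkM d k (U : set 'rV[R]_d) f g :
  open U -> Ck k U f -> Ck k U g -> Ck k U (fun x => f x * g x).
Proof.
move=> oU; elim: k f g => [|k IH] f g ckf ckg; have [cf df] := ckf; have [cg dg] := ckg;
  split=> //; try by move=> x Ux; apply: continuousM; [exact: cf | exact: cg].
move=> i; have [dfi ckfi] := df i; have [dgi ckgi] := dg i.
split=> [x Ux|]; first by apply: derivableM; [exact: dfi|exact: dgi].
apply: Ck_eq (CkD oU (IH _ _ (CkW ckf) ckgi) (IH _ _ (CkW ckg) ckfi)) => // x Ux.
by rewrite /partial (deriveM (dfi x Ux) (dgi x Ux)).
Qed.

Lemma Ck_sum d k (U : set 'rV[R]_d) (I : Type) (r : seq I) (f : I -> 'rV[R]_d -> R) :
  open U -> (forall i, Ck k U (f i)) -> Ck k U (fun x => \sum_(i <- r) f i x).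
Proof.
move=> oU ckf; elim: r => [|i r IH].
  by apply: Ck_eq (@Ck_cst d k U 0) => // x _; rewrite big_nil.
by apply: Ck_eq (CkD oU (ckf i) IH) => // x _; rewrite big_cons.
Qed.

Lemma Ck_chain d m k (U : set 'rV[R]_m) (W : set 'rV[R]_d) (f : 'rV[R]_d -> R)
    (phi : 'rV[R]_m -> 'rV[R]_d) x i :
  open W -> (forall z, U z -> W (phi z)) ->
  (forall j, Ck k.+1 U (fun z => phi z 0 j)) -> Ck k.+1 W f -> U x ->
  is_derive x (delta_mx 0 i) (f \o phi)
    (\sum_j partial i (fun z => phi z 0 j) x * partial j f (phi x)).
Proof.
move=> oW UW cphi cf Ux; apply: (@is_derive_chain R d _ f phi).
- have nW : \forall y \near phi x, W y by exact: open_nbhs_nbhs (conj oW (UW x Ux)).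
  by apply: filterS nW => y Wy j; exact: Ck_derivable cf Wy.
- by move=> j; have [_ /(_ j)[_ ck]] := cf; apply: Ck_continuous ck (UW _ Ux).
- by apply: continuous_row => j; apply: Ck_continuous (cphi j) Ux.
- by move=> j; apply: derivableP; exact: Ck_derivable (cphi j) Ux.
Unshelve. all: by end_near. Qed.

(** Induction on k: by [Ck_chain] the partials of [f \o phi] are sums of products of partials of phi
    with [partial j f \o phi], and the induction hypothesis applies to the latter. *)
Lemma Ck_comp d m k (U : set 'rV[R]_m) (W : set 'rV[R]_d) (f : 'rV[R]_d -> R)
    (phi : 'rV[R]_m -> 'rV[R]_d) :
  open U -> open W -> (forall z, U z -> W (phi z)) ->
  (forall j, Ck k U (fun z => phi z 0 j)) -> Ck k W f -> Ck k U (f \o phi).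
Proof.
move=> oU oW UW; elim: k f => [|k IH] f cphi cf; split=> //;
  try by move=> x Ux; apply: continuous_comp;
    [apply: continuous_row => j; exact: Ck_continuous (cphi j) Ux
    |exact: Ck_continuous cf (UW _ Ux)].
move=> i; have dP x (Ux : U x) := Ck_chain i oW UW cphi cf Ux.
split=> [x Ux|]; first by have [] := dP x Ux.
apply: (Ck_eq (f := fun x => \sum_j partial i (fun z => phi z 0 j) x * (partial j f \o phi) x)) => //.
  by move=> x Ux; have [_ <-] := dP x Ux.
apply: Ck_sum => // j; apply: CkM => //; first exact: ((cphi j).2 i).2.
by apply: IH => [l|]; [exact: CkW (cphi l) | exact: (cf.2 j).2].
Qed.

End Smoothness.

(** * Derivations and vector fields *)

(** What the theory of derivations needs of a smooth structure, stated once for M and for the slit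
    bundle. The latter is a bare subtype with no topology attached, so neighbourhoods are supplied
    as a filter [germ_nbhs]. *)
Record germ_structure (R : realType) (T : Type) (S : T -> set (T -> R)) := GermStructure {
  germ_nbhs : T -> set_system T;
  germ_filter : forall p, Filter (germ_nbhs p);
  germ_center : forall p P, germ_nbhs p P -> P p;
  germ_cst : forall p (a : R), S p (fun=> a);
  germ_add : forall p f g, S p f -> S p g -> S p (fun q => f q + g q);
  germ_mul : forall p f g, S p f -> S p g -> S p (fun q => f q * g q);
  germ_eq : forall p f g, S p f -> germ_nbhs p (fun q => f q = g q) -> S p g;
  germ_open : forall p f, S p f -> germ_nbhs p (fun q => S q f)
}.

Section Tangent.
Context {R : realType} {T : Type} {S : T -> set (T -> R)} (gS : germ_structure S).
Context {p : T} {D : operator R T} (tD : tangent S p D).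
Local Notation N := (germ_nbhs gS).
#[local] Existing Instance germ_filter.

Lemma germ_scale q (a : R) f : S q f -> S q (fun r => a * f r).
Proof. by move=> Sf; apply: (germ_mul gS) => //; exact: germ_cst. Qed.

Lemma germ_opp q f : S q f -> S q (fun r => - f r).
Proof.
move=> /(germ_scale (-1)); rewrite (_ : (fun r => _ ) = fun r => - f r) //.
by apply/funext => r; rewrite mulN1r.
Qed.

Lemma germ_sub q f g : S q f -> S q g -> S q (fun r => f r - g r).
Proof. by move=> Sf Sg; apply: (germ_add gS) => //; exact: germ_opp. Qed.

Lemma tangent0 : D (fun=> 0) = 0.
Proof.
case: tD => lD _ _; have S0 := germ_cst gS p 0.
have := lD 1 _ _ S0 S0; under eq_fun do rewrite mulr0 addr0.
by move=> /eqP; rewrite mul1r -subr_eq0 opprD addNKr oppr_eq0 => /eqP.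
Qed.

Lemma tangent_add f g : S p f -> S p g -> D (fun q => f q + g q) = D f + D g.
Proof.
case: tD => lD _ _ Sf Sg; have := lD 1 _ _ Sf Sg.
by rewrite mul1r; under eq_fun do rewrite mul1r.
Qed.

Lemma tangent_scale (a : R) f : S p f -> D (fun q => a * f q) = a * D f.
Proof.
case: tD => lD _ _ Sf; have := lD a _ _ Sf (germ_cst gS p 0).
by under eq_fun do rewrite addr0; rewrite tangent0 addr0.
Qed.

Lemma tangent_opp f : S p f -> D (fun q => - f q) = - D f.
Proof.
by move=> /(tangent_scale (-1)); under eq_fun do rewrite mulN1r; rewrite mulN1r.
Qed.

Lemma tangent_sub f g : S p f -> S p g -> D (fun q => f q - g q) = D f - D g.
Proof.
by move=> Sf Sg; rewrite tangent_add //; [rewrite tangent_opp|exact: germ_opp].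
Qed.

Lemma tangent_mul f g : S p f -> S p g ->
  D (fun q => f q * g q) = f p * D g + g p * D f.
Proof. by case: tD => _ mD _; exact: mD. Qed.

(** The Leibniz rule on [h * h = h] reads [D h = 2 D h]. This covers the constant 1 as well as
    indicator functions of neighbourhoods of p, which are smooth at p whatever they do far away. *)
Lemma tangent_idem h : S p h -> (fun q => h q * h q) = h -> h p = 1 -> D h = 0.
Proof.
move=> Sh hh h1; have := tangent_mul Sh Sh; rewrite hh h1 mul1r => /eqP.
by rewrite -subr_eq0 opprD addNKr oppr_eq0 => /eqP.
Qed.

Lemma tangent_cst (a : R) : D (fun=> a) = 0.
Proof.
have S1 := germ_cst gS p 1; rewrite (_ : (fun=> a) = fun=> a * 1 :> R).
  rewrite tangent_scale // tangent_idem ?mulr0 //.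
  by apply/funext => q; rewrite mulr1.
by apply/funext => q; rewrite mulr1.
Qed.

(* Multiplying by the indicator function of a neighbourhood, which is
   idempotent and hence killed by D. *)
Lemma tangent_local f g : S p f -> N p (fun q => f q = g q) -> D f = D g.
Proof.
move=> Sf fg; have Sg : S p g by exact: germ_eq fg.
pose h q : R := if `[< f q = g q >] then 1 else 0.
have hp : h p = 1 by rewrite /h; case: asboolP => // -[]; exact: germ_center fg.
have Sh : S p h.
  apply: germ_eq (germ_cst gS p 1) _; apply: filterS fg => q fgq.
  by rewrite /h; case: asboolP.
have Dh : D h = 0.
  by apply: tangent_idem => //; apply/funext => q; rewrite /h; case: ifP; rewrite ?mulr1 ?mulr0.
have := tangent_mul Sf Sh; have := tangent_mul Sg Sh.
rewrite hp Dh !mulr0 !add0r !mul1r => <- <-; congr D; apply/funext => q.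
by rewrite /h; case: asboolP => [->|]; rewrite ?mulr0.
Qed.

End Tangent.

Section VectorFields.
Context {R : realType} {T : Type} {S : T -> set (T -> R)} (gS : germ_structure S).
Local Notation N := (germ_nbhs gS).
Local Notation vf := (vector_field S).
Local Notation br := (bracket S).
#[local] Existing Instance germ_filter.
Implicit Types X Y Z : field R T.

Lemma vf_tangent X u : vf X -> tangent S u (X u). Proof. by case. Qed.

Lemma vf_act X u f : vf X -> S u f -> S u (act X f).
Proof. by case=> _; apply. Qed.

Lemma vf_ext X Y : vf X -> vf Y -> (forall u f, S u f -> X u f = Y u f) -> X = Y.
Proof.
move=> [tX _] [tY _] XY; apply/funext => u; apply/funext => f.
have [Sf|nSf] := pselect (S u f); first exact: XY.
by have [_ _ zX] := tX u; have [_ _ zY] := tY u; rewrite zX // zY.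
Qed.

Lemma tangentZD u D D' (a : R) :
  tangent S u D -> tangent S u D' -> tangent S u (a *: D + D').
Proof.
move=> [l m z] [l' m' z']; have E f : (a *: D + D') f = a * D f + D' f by [].
split=> [b f g Sf Sg|f g Sf Sg|f nSf]; rewrite !E.
- by rewrite l // l' //; ring.
- by rewrite m // m' //; ring.
- by rewrite z // z' // mulr0 addr0.
Qed.

Lemma tangent_zero u : tangent S u (0 : operator R T).
Proof. by split=> [a f g _ _|f g _ _|//]; rewrite /= ?mulr0 ?addr0. Qed.

Lemma vf_scaleD (f : T -> R) X Y : smooth S f -> vf X -> vf Y -> vf (f *v X + Y).
Proof.
move=> Sf [tX sX] [tY sY]; split=> [u|u g Sg]; first exact: tangentZD.
apply: (germ_add gS); last exact: sY.
by apply: (germ_mul gS); [exact: Sf | exact: sX].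
Qed.

Lemma vf0 : vf (0 : field R T).
Proof. by split=> [u|u f Sf]; [exact: tangent_zero | exact: germ_cst]. Qed.

Lemma vfD X Y : vf X -> vf Y -> vf (X + Y).
Proof.
move=> vX vY; rewrite (_ : X = (fun=> 1) *v X); first by apply: vf_scaleD => // u; exact: germ_cst.
by apply/funext => u; rewrite /scale_field scale1r.
Qed.

Lemma vf_scale f X : smooth S f -> vf X -> vf (f *v X).
Proof. by move=> Sf vX; rewrite -[_ *v _]addr0; apply: vf_scaleD => //; exact: vf0. Qed.

Lemma vfN X : vf X -> vf (- X).
Proof.
move=> vX; rewrite (_ : - X = (fun=> -1) *v X); first by apply: vf_scale => // u; exact: germ_cst.
by apply/funext => u; rewrite /scale_field scaleN1r.
Qed.

Lemma vfB X Y : vf X -> vf Y -> vf (X - Y).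
Proof. by move=> vX vY; apply: vfD => //; exact: vfN. Qed.

Lemma bracketE X Y u f : S u f -> br X Y u f = X u (act Y f) - Y u (act X f).
Proof. by move=> Sf; rewrite /bracket /restrict_op; case: asboolP. Qed.

Lemma bracket_near X Y u f : S u f ->
  N u (fun q => act (br X Y) f q = X q (act Y f) - Y q (act X f)).
Proof. by move=> Sf; apply: filterS (germ_open gS Sf) => q; exact: bracketE. Qed.

Lemma bracket_vf X Y : vf X -> vf Y -> vf (br X Y).
Proof.
move=> vX vY; split=> [u|u f Sf]; last first.
  apply: germ_eq; last by apply: filterS (bracket_near X Y Sf) => q; exact: esym.
  by apply: (germ_sub gS); do 2 apply: vf_act => //.
have tX := vf_tangent u vX; have tY := vf_tangent u vY.
split=> [a f g Sf Sg|f g Sf Sg|f nSf]; last first.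
- by rewrite /bracket /restrict_op; case: asboolP.
- rewrite !bracketE //; last exact: germ_mul.
  (* The Leibniz formula for Z holds only where f and g are smooth, that is near u, so the outer
     derivation is carried across it by [tangent_local]. *)
  have aM Z : vf Z -> N u (fun q => f q * act Z g q + g q * act Z f q =
      act Z (fun q => f q * g q) q).
    move=> vZ; near=> q; rewrite [RHS](tangent_mul (vf_tangent q vZ)) //.
      by near: q; exact: germ_open.
    by near: q; exact: germ_open.
  have Sm Z : vf Z -> S u (fun q => f q * act Z g q + g q * act Z f q).
    by move=> vZ; apply: (germ_add gS); apply: (germ_mul gS) => //; exact: vf_act.
  rewrite -(tangent_local tX (Sm _ vY) (aM _ vY)) -(tangent_local tY (Sm _ vX) (aM _ vX)).
  rewrite (tangent_add tX) ?(tangent_add tY);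
    try by apply: (germ_mul gS) => //; exact: vf_act.
  by rewrite !(tangent_mul tX, tangent_mul tY) //; try exact: vf_act; rewrite /act; ring.
- rewrite !bracketE //; last by apply: (germ_add gS) => //; exact: (germ_scale gS).
  have aM Z : vf Z -> N u (fun q => a * act Z f q + act Z g q =
      act Z (fun q => a * f q + g q) q).
    move=> vZ; near=> q; have [lZ _ _] := vf_tangent q vZ; rewrite [RHS]lZ //.
      by near: q; exact: germ_open.
    by near: q; exact: germ_open.
  have Sm Z : vf Z -> S u (fun q => a * act Z f q + act Z g q).
    by move=> vZ; apply: (germ_add gS); [apply: (germ_scale gS)|]; exact: vf_act.
  rewrite -(tangent_local tX (Sm _ vY) (aM _ vY)) -(tangent_local tY (Sm _ vX) (aM _ vX)).
  case: tX => lX _ _; rewrite lX; try exact: vf_act.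
  by case: tY => lY _ _; rewrite lY; try exact: vf_act; rewrite /act; ring.
Unshelve. all: by end_near. Qed.

End VectorFields.

(** * Smooth atlases *)

Section SmoothNear.
Context {R : realType} {d : nat} {I T : Type}.
Context (U : I -> set 'rV[R]_d) (phi : I -> 'rV[R]_d -> option T).

Record atlas : Prop := Atlas {
  atlas_open : forall c, open (U c);
  atlas_def : forall c z, U c z -> exists p, phi c z = Some p;
  atlas_cover : forall p, exists c z, U c z /\ phi c z = Some p;
  atlas_transition : forall c z c' z', U c z -> U c' z' -> phi c z = phi c' z' ->
    exists V tau, [/\ open V, V z, V `<=` U c, tau z = z' &
      (forall j, smooth_on V (fun w => tau w 0 j)) /\
      (forall w, V w -> U c' (tau w) /\ phi c w = phi c' (tau w))]
}.

(** Neighbourhoods without a topology on T: P must hold near the coordinates of p in every chart. At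
    a point met by no chart the condition is vacuous, so it is [atlas_cover] that makes the filter
    centred. *)
Definition chart_nbhs (p : T) : set_system T :=
  [set P | forall c z, U c z -> phi c z = Some p ->
     \forall w \near z, forall q, phi c w = Some q -> P q].

Hypothesis aP : atlas.

Lemma chart_nbhs_filter p : Filter (chart_nbhs p).
Proof.
split=> [c z _ _|P Q NP NQ c z Uz cz|P Q PQ NP c z Uz cz].
- by apply: filterE.
- by apply: filterS2 (NP c z Uz cz) (NQ c z Uz cz) => w Pw Qw q wq; split; [exact: Pw|exact: Qw].
- by apply: filterS (NP c z Uz cz) => w Pw q /Pw /PQ.
Qed.

Lemma chart_nbhs_center p P : chart_nbhs p P -> P p.
Proof.
move=> NP; have [c [z [Uz cz]]] := atlas_cover aP p.
exact: nbhs_singleton (NP c z Uz cz) _ cz.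
Qed.

Lemma smooth_near_cst p (a : R) : smooth_near U phi p (fun=> a).
Proof.
move=> c z Uz _; exists (U c); split=> // [|k]; first exact: atlas_open.
apply: Ck_eq (Ck_cst _ _ a); first exact: atlas_open.
by move=> w /(atlas_def aP)[q ->].
Qed.

Lemma smooth_near_add p f g : smooth_near U phi p f -> smooth_near U phi p g ->
  smooth_near U phi p (fun q => f q + g q).
Proof.
move=> Sf Sg c z Uz cz; have [V [oV Vz VU fV]] := Sf c z Uz cz.
have [W [oW Wz WU gW]] := Sg c z Uz cz; have oVW := openI oV oW.
exists (V `&` W); split=> // [w [/VU]//|k].
apply: Ck_eq (CkD oVW (Ck_subset (@subIsetl _ V W) (fV k)) (Ck_subset (@subIsetr _ V W) (gW k))) => // w _.
by case: (phi c w) => //=; rewrite addr0.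
Qed.

Lemma smooth_near_mul p f g : smooth_near U phi p f -> smooth_near U phi p g ->
  smooth_near U phi p (fun q => f q * g q).
Proof.
move=> Sf Sg c z Uz cz; have [V [oV Vz VU fV]] := Sf c z Uz cz.
have [W [oW Wz WU gW]] := Sg c z Uz cz; have oVW := openI oV oW.
exists (V `&` W); split=> // [w [/VU]//|k].
apply: Ck_eq (CkM oVW (Ck_subset (@subIsetl _ V W) (fV k)) (Ck_subset (@subIsetr _ V W) (gW k))) => // w _.
by case: (phi c w) => //=; rewrite mulr0.
Qed.

Lemma smooth_near_eq p f g : smooth_near U phi p f ->
  chart_nbhs p (fun q => f q = g q) -> smooth_near U phi p g.
Proof.
move=> Sf fg c z Uz cz; have [V [oV Vz VU fV]] := Sf c z Uz cz.
have : nbhs z [set w | forall q, phi c w = Some q -> f q = g q] by exact: fg.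
rewrite nbhsE => -[W [oW Wz] fgW]; have oVW := openI oV oW.
exists (V `&` W); split=> // [w [/VU]//|k].
apply: Ck_eq (Ck_subset (@subIsetl _ V W) (fV k)) => // w [/VU/(atlas_def aP)[q wq] /fgW/(_ q wq)].
by rewrite wq.
Qed.

(** At a point q near p smoothness must be checked in every chart c' through q, not just in the
    chart c where f is known to be smooth around p. There f is its expression in c composed with the
    change of charts [tau], which goes from c' to c. *)
Lemma smooth_near_open p f : smooth_near U phi p f ->
  chart_nbhs p (fun q => smooth_near U phi q f).
Proof.
move=> Sf c z Uz cz; have [V [oV Vz VU fV]] := Sf c z Uz cz.
near=> w => q wq c' w' Uw' cw'.
have Vw : V w by near: w; exact: open_nbhs_nbhs.
have [||W [tau [oW Ww' WU tw' [tauS tauP]]]] := @atlas_transition aP c' w' c w Uw'.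
- exact: VU.
- by rewrite cw' wq.
have tau_cont x : W x -> {for x, continuous tau}.
  by move=> Wx; apply: continuous_row => j; exact: Ck_continuous (tauS j 0%N) Wx.
pose W' := W `&` tau @^-1` V.
have oW' : open W'.
  rewrite openE => x [Wx Vx]; apply: filterI; first exact: open_nbhs_nbhs.
  by apply: (tau_cont x Wx); exact: open_nbhs_nbhs.
exists W'; split=> // [|x [/WU]//|k]; first by split=> //=; rewrite tw'.
apply: Ck_eq (Ck_comp oW' oV _ _ (fV k)); first by [].
- by move=> x [/tauP[_ ->]].
- by move=> x [].
- by move=> j; exact: Ck_subset (@subIsetl _ _ _) (tauS j k).
Unshelve. all: by end_near. Qed.

Definition smooth_near_germs : germ_structure (smooth_near U phi) :=
  GermStructure chart_nbhs_filter chart_nbhs_center smooth_near_cst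
    smooth_near_add smooth_near_mul smooth_near_eq smooth_near_open.

End SmoothNear.

Section PartialRules.
Context {R : realType} {d : nat}.
Implicit Types f g : 'rV[R]_d -> R.

Lemma partial_near f g x i : (\forall y \near x, f y = g y) ->
  partial i f x = partial i g x.
Proof. exact: near_eq_derive. Qed.

Lemma partial_lin (a : R) f g x i :
  derivable f x (delta_mx 0 i) -> derivable g x (delta_mx 0 i) ->
  partial i (fun y => a * f y + g y) x = a * partial i f x + partial i g x.
Proof.
move=> df dg; rewrite /partial -[fun y => _]/((a *: f) + g).
by rewrite deriveD ?deriveZ //; exact: derivableZ.
Qed.

Lemma partial_mul f g x i :
  derivable f x (delta_mx 0 i) -> derivable g x (delta_mx 0 i) ->
  partial i (fun y => f y * g y) x = f x * partial i g x + g x * partial i f x.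
Proof. by move=> df dg; rewrite /partial -[fun y => _]/(f * g) deriveM. Qed.

Lemma partial_coord x i j : partial i (fun y : 'rV[R]_d => y 0 j) x = (i == j)%:R.
Proof. by have [_ ] := is_derive_coord i j x. Qed.

End PartialRules.

(** * Charts of the base and of the slit tangent bundle *)

Section TangentCharts.
Context {R : realType} {n : nat} (M : manifold R n).
Implicit Types (c : chart M) (p : M) (x y w : 'rV[R]_n) (z : 'rV[R]_(n + n)).

Lemma cod_par c x : cod c x -> dom c (par c x) /\ crd c (par c x) = x.
Proof. by move=> [p cp <-]; rewrite crdK. Qed.

Lemma dom_crd c p : dom c p -> cod c (crd c p).
Proof. by exists p. Qed.

Definition overlap c c' : set 'rV[R]_n := crd c @` (dom c `&` dom c').

Lemma overlapP c c' x : overlap c c' x <-> cod c x /\ dom c' (par c x).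
Proof.
split=> [[p [cp c'p] <-]|[cx c'x]]; first by split; [exists p|rewrite crdK].
by have [dx xE] := cod_par cx; exists (par c x).
Qed.

Lemma overlap_open c c' : open (overlap c c').
Proof.
rewrite openE => x /overlapP[cx c'x]; have oc := @crd_open _ _ M c; near=> y.
apply/overlapP; split; first by near: y; exact: open_nbhs_nbhs.
near: y; apply: (par_continuous cx); exact: (open_nbhs_nbhs (conj (@dom_open _ _ M c') c'x)).
Unshelve. all: by end_near. Qed.

Lemma smooth_near_chart c x g : cod c x -> smM (par c x) g ->
  exists V : set 'rV[R]_n, [/\ open V, V x, V `<=` cod c & smooth_on V (g \o par c)].
Proof. by move=> cx /(_ c x cx erefl). Qed.

Lemma base_atlas : atlas (@cod R n M) (fun c x => Some (par c x)).
Proof.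
split=> [c|c x _|p|c x c' x' cx c'x' [xx']]; first exact: crd_open.
- by exists (par c x).
- have [c _ cp] : (\bigcup_c dom c) p by rewrite (dom_cover M).
  by exists c, (crd c p); split; [exact: dom_crd | rewrite crdK].
- exists (overlap c c'), (fun w => crd c' (par c w)); split; first exact: overlap_open.
  + by apply/overlapP; split=> //; rewrite xx'; case: (cod_par c'x').
  + by move=> w /overlapP[].
  + by rewrite xx'; case: (cod_par c'x').
  + split=> [j|w /overlapP[cw c'w]]; first exact: transition_smooth.
    by split; [exact: dom_crd | rewrite crdK].
Qed.

Definition gM : germ_structure (@smM R n M) := smooth_near_germs base_atlas.

Lemma crd_smooth c p j : dom c p -> smM p (fun q => crd c q 0 j).
Proof.
move=> cp c' x' c'x' [px']; exists (overlap c' c); split.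
- exact: overlap_open.
- by apply/overlapP; split=> //; rewrite px'.
- by move=> w /overlapP[].
- exact: transition_smooth.
Qed.

Lemma restrict_op_tangent (T : Type) (S : T -> set (T -> R)) (gS : germ_structure S)
    (p : T) (D : operator R T) :
  (forall (a : R) f g, S p f -> S p g -> D (fun q => a * f q + g q) = a * D f + D g) ->
  (forall f g, S p f -> S p g -> D (fun q => f q * g q) = f p * D g + g p * D f) ->
  tangent S p (restrict_op S p D).
Proof.
move=> lD mD; split=> [a f g Sf Sg|f g Sf Sg|f nSf]; rewrite /restrict_op.
- rewrite !asboolT ?lD //; apply: (germ_add gS) => //; exact: (germ_scale gS).
- by rewrite !asboolT ?mD //; exact: (germ_mul gS).
- by rewrite asboolF.
Qed.

Definition coord_op c x y : operator R M := restrict_op (@smM R n M) (par c x) (fun g =>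
  \sum_j y 0 j * partial j (g \o par c) x).

Lemma coord_vecE c z :
  coord_vec c z = (par c (lsubmx z), coord_op c (lsubmx z) (rsubmx z)).
Proof. by []. Qed.

Lemma coord_opE c x y g : smM (par c x) g ->
  coord_op c x y g = \sum_j y 0 j * partial j (g \o par c) x.
Proof. by move=> Sg; rewrite /coord_op /restrict_op asboolT. Qed.

Lemma coord_op_tangent c x y : cod c x -> tangent (@smM R n M) (par c x) (coord_op c x y).
Proof.
move=> cx.
have dg g j : smM (par c x) g -> derivable (g \o par c) x (delta_mx 0 j).
  by move=> /(smooth_near_chart cx)[V [oV Vx _ gV]]; exact: Ck_derivable (gV 1%N) Vx.
apply: (restrict_op_tangent gM) => [a f g Sf Sg|f g Sf Sg].
- rewrite mulr_sumr -big_split; apply: eq_bigr => j _ /=.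
  by rewrite [X in _ * X = _](partial_lin a (dg f j Sf) (dg g j Sg)); ring.
- rewrite !mulr_sumr -big_split; apply: eq_bigr => j _ /=.
  by rewrite [X in _ * X = _](partial_mul (dg f j Sf) (dg g j Sg)) /=; ring.
Qed.

Lemma coord_op_crd c x y k : cod c x -> coord_op c x y (fun q => crd c q 0 k) = y 0 k.
Proof.
move=> cx; have [cp xE] := cod_par cx; rewrite coord_opE; last exact: crd_smooth.
have dE j : partial j ((fun q => crd c q 0 k) \o par c) x = (j == k)%:R.
  rewrite -(partial_coord x j k); apply: partial_near; near=> w.
  have [|_ /= -> //] := @cod_par c w; near: w.
  exact: open_nbhs_nbhs (conj (@crd_open _ _ M c) cx).
rewrite (bigD1 k) //= big1 => [|j jk]; rewrite dE; first by rewrite eqxx mulr1 addr0.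
by rewrite (negbTE jk) mulr0.
Unshelve. all: by end_near. Qed.

Lemma coord_op_inj c x y y' : cod c x -> coord_op c x y = coord_op c x y' -> y = y'.
Proof.
move=> cx yy'; apply/rowP => k.
by rewrite -(coord_op_crd y k cx) -(coord_op_crd y' k cx) yy'.
Qed.

Lemma coord_op0 c x : coord_op c x 0 = 0.
Proof.
apply/funext => g; rewrite /coord_op /restrict_op; case: asboolP => // _.
by rewrite big1 // => j _; rewrite mxE mul0r.
Qed.

Lemma coord_op_lin c x y y' (t : R) :
  coord_op c x (y + t *: y') = coord_op c x y + t *: coord_op c x y'.
Proof.
apply/funext => g; rewrite -[RHS]/(coord_op c x y g + t * coord_op c x y' g).
rewrite /coord_op /restrict_op; case: asboolP => _; last by rewrite mulr0 addr0.
by rewrite mulr_sumr -big_split; apply: eq_bigr => j _; rewrite !mxE /=; ring.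
Qed.

(** The Jacobian matrix at x of the change of charts from c to c', applied to y. *)
Definition transition_row c c' x y : 'rV[R]_n :=
  \row_k \sum_j y 0 j * partial j (fun w => crd c' (par c w) 0 k) x.

(** Near x, [g \o par c] is [g \o par c'] composed with the change of charts, so this is the chain
    rule followed by an exchange of sums. *)
Lemma coord_op_transition c c' x y : overlap c c' x ->
  coord_op c x y = coord_op c' (crd c' (par c x)) (transition_row c c' x y).
Proof.
move=> ox; have /overlapP[cx c'x] := ox; apply/funext => g.
have c'y := dom_crd c'x; have pE : par c' (crd c' (par c x)) = par c x by rewrite crdK.
rewrite /coord_op pE /restrict_op; case: asboolP => // Sg.
have [|W [oW Wy Wc gW]] := @smooth_near_chart c' (crd c' (par c x)) g c'y.
  by rewrite pE.
under [RHS]eq_bigr do rewrite mxE mulr_suml.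
rewrite exchange_big; apply: eq_bigr => j _ /=.
under eq_bigr do rewrite -mulrA; rewrite -mulr_sumr; congr (_ * _).
have trC l k : Ck l (overlap c c') (fun w => crd c' (par c w) 0 k).
  exact: transition_smooth.
have [_ <-] : is_derive x (delta_mx 0 j) ((g \o par c') \o (fun w => crd c' (par c w)))
    (\sum_i partial j (fun w => crd c' (par c w) 0 i) x *
            partial i (g \o par c') (crd c' (par c x))).
  apply: (@is_derive_chain R n _ (g \o par c') (fun w => crd c' (par c w))).
  - have : \forall y0 \near crd c' (par c x), W y0 by exact: open_nbhs_nbhs.
    by apply: filterS => y0 Wy0 i; exact: Ck_derivable (gW 1%N) Wy0.
  - by move=> i; have [_ /(_ i)[_ ck]] := gW 1%N; exact: ck.1 _ Wy.
  - by apply: continuous_row => k; exact: Ck_continuous (trC 0%N k) ox.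
  - by move=> i; apply: derivableP; exact: Ck_derivable (trC 1%N i) ox.
apply: near_eq_derive; near=> w; rewrite /= crdK //.
have /overlapP[_ //] : overlap c c' w.
by near: w; exact: open_nbhs_nbhs (conj (@overlap_open c c') ox).
Unshelve. all: by end_near. Qed.

Lemma mkslitP (v : M * operator R M) (u : slit M) : mkslit v = Some u <-> val (val u) = v.
Proof.
rewrite /mkslit /mkTM; split=> [|<-]; last by rewrite valK /= valK.
by case: insubP => //= t _ <-; case: insubP => //= s _ <- [<-].
Qed.

Lemma slit_chart c z : slit_cod c z -> exists u, mkslit (coord_vec c z) = Some u.
Proof.
move=> [cz z0].
have tz : `[< tangent (@smM R n M) (coord_vec c z).1 (coord_vec c z).2 >].
  by apply/asboolP; exact: coord_op_tangent.
pose t : TM M := exist _ (coord_vec c z) tz.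
have nz : (val t).2 != 0.
  apply: contra z0 => /eqP E; apply/eqP; apply: (coord_op_inj cz).
  by rewrite coord_op0.
by exists (exist (fun u : TM M => (val u).2 != 0) t nz); apply/mkslitP.
Qed.

Lemma mkslit_coord c z u : mkslit (coord_vec c z) = Some u ->
  base u = par c (lsubmx z) /\ vec u = coord_op c (lsubmx z) (rsubmx z).
Proof. by move=> /mkslitP E; rewrite /base /vec E. Qed.

Lemma mkslit_inj c z z' : slit_cod c z -> slit_cod c z' ->
  mkslit (coord_vec c z) = mkslit (coord_vec c z') -> z = z'.
Proof.
move=> cz cz'; have [u zu] := slit_chart cz; rewrite zu => /esym zu'.
have [b v] := mkslit_coord zu; have [b' v'] := mkslit_coord zu'.
have lz : lsubmx z = lsubmx z'.
  have [_ <-] := cod_par cz.1; have [_ <-] := cod_par cz'.1.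
  by rewrite -b -b'.
rewrite -(hsubmxK z) -(hsubmxK z') lz; congr row_mx.
by apply: (coord_op_inj cz'.1); rewrite -v' v lz.
Qed.

Lemma slit_cod_open c : open (slit_cod c).
Proof.
apply: openI.
  by apply: open_comp (@crd_open _ _ M c) => z _; exact: continuous_lsubmx.
apply: open_comp (_ : open [set y : 'rV[R]_n | y != 0]) => [z _|].
  exact: continuous_rsubmx.
rewrite (_ : [set _ | _] = ~` [set 0]).
  by rewrite openC; exact/accessible_closed_set1/hausdorff_accessible/norm_hausdorff.
by apply/seteqP; split=> y /= /eqP.
Qed.

Definition slit_transition c c' z : 'rV[R]_(n + n) :=
  row_mx (crd c' (par c (lsubmx z))) (transition_row c c' (lsubmx z) (rsubmx z)).

Definition slit_overlap c c' : set 'rV[R]_(n + n) :=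
  [set z | overlap c c' (lsubmx z)] `&` slit_cod c.

Lemma slit_overlap_open c c' : open (slit_overlap c c').
Proof.
apply: openI (@slit_cod_open c).
by apply: open_comp (@overlap_open c c') => z _; exact: continuous_lsubmx.
Qed.

Lemma lsubmx_Ck k (U : set 'rV[R]_(n + n)) j : Ck k U (fun z => lsubmx z 0 j).
Proof.
rewrite (_ : (fun z => _) = fun z => z 0 (lshift n j)); first exact: Ck_coord.
by apply/funext => z; rewrite mxE.
Qed.

Lemma rsubmx_Ck k (U : set 'rV[R]_(n + n)) j : Ck k U (fun z => rsubmx z 0 j).
Proof.
rewrite (_ : (fun z => _) = fun z => z 0 (rshift n j)); first exact: Ck_coord.
by apply/funext => z; rewrite mxE.
Qed.

Lemma slit_transition_smooth c c' j :
  smooth_on (slit_overlap c c') (fun z => slit_transition c c' z 0 j).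
Proof.
move=> k; have oO := @slit_overlap_open c c'; have oM := @overlap_open c c'.
have lO z : slit_overlap c c' z -> overlap c c' (lsubmx z) by case.
(* The first n components are the change of charts itself. The last n are linear in y with its
   partial derivatives as coefficients, which is why class [k.+1] is asked of it. *)
rewrite -(splitK j) /slit_transition; case: (fintype.split j) => i /=.
  apply: (@Ck_eq _ _ _ _ ((fun x => crd c' (par c x) 0 i) \o lsubmx)) => //.
    by move=> z _; rewrite row_mxEl.
  apply: Ck_comp (transition_smooth (m := M) c c' i k) => // l.
  exact: lsubmx_Ck.
apply: (@Ck_eq _ _ _ _ (fun z => \sum_l rsubmx z 0 l *
    (partial l (fun x => crd c' (par c x) 0 i) \o lsubmx) z)) => //.
  by move=> z _; rewrite row_mxEr mxE.
apply: Ck_sum => // l; apply: CkM => //; first exact: rsubmx_Ck.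
apply: (Ck_comp (W := overlap c c')) => // [l'|]; first exact: lsubmx_Ck.
exact: ((transition_smooth (m := M) c c' i k.+1).2 l).2.
Qed.

Lemma slit_transitionP c c' z : slit_overlap c c' z ->
  slit_cod c' (slit_transition c c' z) /\
  coord_vec c z = coord_vec c' (slit_transition c c' z).
Proof.
move=> [oz [cz z0]]; have /overlapP[_ c'z] := oz.
have E : coord_vec c z = coord_vec c' (slit_transition c c' z).
  by rewrite !coord_vecE /slit_transition row_mxKl row_mxKr crdK // -coord_op_transition.
split=> //; split; first by rewrite /slit_transition row_mxKl; exact: dom_crd.
apply: contra z0 => /eqP E0; apply/eqP; apply: (coord_op_inj cz).
have := congr1 snd E; rewrite !coord_vecE /= => ->.
by rewrite E0 !coord_op0.
Qed.

Lemma slit_overlap_base c c' z u : slit_cod c z -> mkslit (coord_vec c z) = Some u ->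
  dom c' (base u) -> slit_overlap c c' z.
Proof.
move=> cz zu c'u; split=> //; apply/overlapP; split; first by case: cz.
by have [<- _] := mkslit_coord zu.
Qed.

Lemma slit_recoord c c' z u : slit_cod c z -> mkslit (coord_vec c z) = Some u ->
  dom c' (base u) -> exists z', slit_cod c' z' /\ mkslit (coord_vec c' z') = Some u.
Proof.
move=> cz zu c'u; have [cz' zE] := slit_transitionP (slit_overlap_base cz zu c'u).
by exists (slit_transition c c' z); rewrite -zE.
Qed.

(** The hypothesis says that each nonzero derivation is a combination of the d/dx^j of some chart;
    all other atlas axioms hold without it. It is supplied later by [slit_cover]. *)
Lemma slit_atlas :
  (forall u : slit M, exists c z, slit_cod c z /\ mkslit (coord_vec c z) = Some u) ->
  atlas (@slit_cod R n M) (fun c z => mkslit (coord_vec c z)).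
Proof.
move=> cov; split=> [c|c z|//|c z c' z' cz c'z' zz']; first exact: slit_cod_open.
  exact: slit_chart.
have [u zu] := slit_chart cz; have zu' : mkslit (coord_vec c' z') = Some u by rewrite -zz'.
have c'u : dom c' (base u).
  by have [-> _] := mkslit_coord zu'; have [] := cod_par c'z'.1.
have oz := slit_overlap_base cz zu c'u.
exists (slit_overlap c c'), (slit_transition c c'); split=> //.
- exact: slit_overlap_open.
- by move=> w [].
- have [tz E] := slit_transitionP oz.
  by apply: (mkslit_inj tz c'z'); rewrite -E zu zu'.
- split=> [j|w /slit_transitionP[? ->]//]; exact: slit_transition_smooth.
Qed.

End TangentCharts.

Section SmoothAt.
Context {R : realType} {d : nat}.
Implicit Types (z : 'rV[R]_d) (f g : 'rV[R]_d -> R).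

Definition smooth_at z f := exists V : set 'rV[R]_d, [/\ open V, V z & smooth_on V f].

Lemma smooth_atM z f g : smooth_at z f -> smooth_at z g -> smooth_at z (fun w => f w * g w).
Proof.
move=> [V [oV Vz fV]] [W [oW Wz gW]]; have oVW := openI oV oW.
exists (V `&` W); split=> // k.
by apply: CkM => //; [apply: Ck_subset (fV k)|apply: Ck_subset (gW k)] => x [].
Qed.

Lemma smooth_at_sum z (I : Type) (r : seq I) (f : I -> 'rV[R]_d -> R) :
  (forall i, smooth_at z (f i)) -> smooth_at z (fun w => \sum_(i <- r) f i w).
Proof.
move=> fP; elim: r => [|i r [W [oW Wz gW]]].
  exists setT; split=> //; first exact: openT.
  by move=> k; apply: Ck_eq (Ck_cst _ _ 0); [exact: openT|move=> w _; rewrite big_nil].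
have [V [oV Vz fV]] := fP i; have oVW := openI oV oW.
exists (V `&` W); split=> // k.
apply: (@Ck_eq _ _ _ _ (fun w => f i w + \sum_(i <- r) f i w)) => //.
  by move=> w _; rewrite big_cons.
by apply: CkD => //; [apply: Ck_subset (fV k)|apply: Ck_subset (gW k)] => x [].
Qed.

Lemma smooth_at_eq z f g : smooth_at z f -> (\forall w \near z, f w = g w) -> smooth_at z g.
Proof.
move=> [V [oV Vz fV]] fg; have : nbhs z [set w | f w = g w] by exact: fg.
rewrite nbhsE => -[W [oW Wz] WP]; have oVW := openI oV oW.
exists (V `&` W); split=> // k.
by apply: (@Ck_eq _ _ _ _ f) => // [x [_ /WP]//|]; apply: Ck_subset (fV k) => x [].
Qed.

Lemma smooth_at_partial z f i : smooth_at z f -> smooth_at z (partial i f).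
Proof. by move=> [V [oV Vz fV]]; exists V; split=> // k; exact: ((fV k.+1).2 i).2. Qed.

Lemma smooth_at_derivable z f i : smooth_at z f -> derivable f z (delta_mx 0 i).
Proof. by move=> [V [_ Vz fV]]; exact: Ck_derivable (fV 1%N) Vz. Qed.

Lemma smooth_at_chain z v f : smooth_at z f ->
  is_derive (0 : R) 1 (fun t : R => f (z + t *: v)) (\sum_j v 0 j * partial j f z).
Proof.
move=> [V [oV Vz fV]].
have -> : (fun t : R => f (z + t *: v)) = f \o (fun t : R => z + t *: v) by [].
have z0 : z = z + (0 : R) *: v by rewrite scale0r addr0.
rewrite [X in \sum_j _ * partial j f X]z0; apply: is_derive_chain; rewrite -?z0.
- have : \forall y \near z, V y by exact: open_nbhs_nbhs.
  by apply: filterS => y Vy j; exact: Ck_derivable (fV 1%N) Vy.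
- by move=> j; have [_ /(_ j)[_ ck]] := fV 1%N; exact: ck.1 _ Vz.
- apply: continuous_row => j; apply: differentiable_continuous.
  rewrite (_ : (fun t : R => _) = (fun t : R => z 0 j + t * v 0 j)) //.
  by apply/funext => t; rewrite !mxE.
- move=> j; apply: is_derive_cvg.
  apply: (@cvg_trans _ ((fun=> v 0 j) @ (0 : R)^')); last exact: cvg_cst.
  apply: near_eq_cvg; near=> h.
  rewrite !mxE addr0 mul0r addr0 addrAC subrr add0r [_%:A]mulr1.
  rewrite -[RHS]/(h^-1 * (h * v 0 j)) mulKf //.
  by near: h; exact: nbhs_dnbhs_neq.
Unshelve. all: by end_near. Qed.

End SmoothAt.

Lemma smooth_at_comp {R : realType} {d m : nat} (z : 'rV[R]_m) (f : 'rV[R]_d -> R)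
    (phi : 'rV[R]_m -> 'rV[R]_d) :
  (forall j k, Ck k setT (fun w => phi w 0 j)) -> smooth_at (phi z) f ->
  smooth_at z (f \o phi).
Proof.
move=> sphi [V [oV Vz fV]]; have oT := @openT 'rV[R]_m.
have oW : open (phi @^-1` V).
  apply: open_comp oV => w _; apply: continuous_row => j.
  exact: Ck_continuous (sphi j 0%N) I.
exists (phi @^-1` V); split=> // k; apply: Ck_comp (fV k) => // j.
exact: Ck_subset (sphi j k).
Qed.

Section SlitFunctions.
Context {R : realType} {n : nat} (M : manifold R n).
Implicit Types (c : chart M) (p : M) (z : 'rV[R]_(n + n)) (u : slit M).

Definition local_rep c (f : slit M -> R) z : R := oapp f 0 (mkslit (coord_vec c z)).

Lemma smM_rep c x g : cod c x -> smM (par c x) g -> smooth_at x (g \o par c).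
Proof. by move=> cx /(smooth_near_chart cx)[V [oV Vx _ gV]]; exists V. Qed.

Lemma smT_rep c z u f : slit_cod c z -> mkslit (coord_vec c z) = Some u ->
  smT u f -> smooth_at z (local_rep c f).
Proof. by move=> cz zu /(_ c z cz zu)[V [oV Vz _ fV]]; exists V. Qed.

Lemma rep_smT u f : (forall c z, slit_cod c z -> mkslit (coord_vec c z) = Some u ->
  smooth_at z (local_rep c f)) -> smT u f.
Proof.
move=> fP c z cz zu; have [V [oV Vz fV]] := fP c z cz zu.
exists (V `&` slit_cod c); split=> //; first exact: openI oV (@slit_cod_open _ _ _ c).
by move=> k; apply: Ck_subset (fV k) => w [].
Qed.

Lemma slit_cod_near c z : slit_cod c z -> \forall w \near z, slit_cod c w.
Proof. by move=> cz; exact: open_nbhs_nbhs (conj (@slit_cod_open _ _ _ c) cz). Qed.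

Lemma smM_near c z g : cod c (lsubmx z) -> smM (par c (lsubmx z)) g ->
  \forall w \near z, smM (par c (lsubmx w)) g.
Proof.
move=> cz Sg; have gn : \forall x \near lsubmx z, smM (par c x) g.
  by have := germ_open (gM M) Sg _ _ cz erefl; apply: filterS => x; apply.
exact: (@continuous_lsubmx _ _ _ _ z) gn.
Qed.

Lemma base_smooth u g : smM (base u) g -> smT u (g \o base (M := M)).
Proof.
move=> Sg; apply: rep_smT => c z cz zu; have [bu _] := mkslit_coord zu.
rewrite bu in Sg; have := smM_rep cz.1 Sg.
move=> /(smooth_at_comp (fun j k => lsubmx_Ck k setT j)) /smooth_at_eq; apply.
apply: filterS (slit_cod_near cz) => w cw; have [q wq] := slit_chart cw.
by rewrite /local_rep wq /=; have [-> _] := mkslit_coord wq.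
Qed.

(** In a chart this function is sum_j y^j d_j g(x), a polynomial in y with coefficients smooth in
    x. *)
Lemma vec_smooth u g : smM (base u) g -> smT u (fun v => vec v g).
Proof.
move=> Sg; apply: rep_smT => c z cz zu; have [bu _] := mkslit_coord zu.
rewrite bu in Sg; have gz := smM_rep cz.1 Sg.
apply: (@smooth_at_eq _ _ _ (fun w => \sum_j rsubmx w 0 j *
    (partial j (g \o par c) \o lsubmx) w)).
  apply: smooth_at_sum => j; apply: smooth_atM.
    by exists setT; split; [exact: openT|by []|move=> k; exact: rsubmx_Ck].
  apply: (smooth_at_comp (fun j k => lsubmx_Ck k setT j)).
  exact: smooth_at_partial.
near=> w; have cw : slit_cod c w by near: w; exact: slit_cod_near.
have Sgw : smM (par c (lsubmx w)) g by near: w; exact: smM_near cz.1 Sg.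
have [q wq] := slit_chart cw; rewrite /local_rep wq /=.
by have [_ ->] := mkslit_coord wq; rewrite coord_opE.
Unshelve. all: by end_near. Qed.

Lemma eta_pi : pi_vector_field (@eta R n M).
Proof.
split=> [u|u g Sg]; last exact: vec_smooth.
by have /asboolP := valP (val u).
Qed.

Lemma mkslit_def p (D : operator R M) : tangent (@smM R n M) p D -> D != 0 ->
  exists u, mkslit (p, D) = Some u.
Proof.
move=> tD nD.
have tu : `[< tangent (@smM R n M) (p, D).1 (p, D).2 >] by apply/asboolP.
pose t : TM M := exist _ (p, D) tu; have nt : (val t).2 != 0 by [].
by exists (exist (fun u : TM M => (val u).2 != 0) t nt); apply/mkslitP.
Qed.

End SlitFunctions.

(** * The vertical lift in coordinates *)

Section VerticalLift.
Context {R : realType} {n : nat} (M : manifold R n).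
Implicit Types (c : chart M) (p : M) (z : 'rV[R]_(n + n)) (u : slit M).
Hypothesis cov :
  forall u : slit M, exists c z, slit_cod c z /\ mkslit (coord_vec c z) = Some u.

Definition gT : germ_structure (@smT R n M) := smooth_near_germs (slit_atlas cov).
#[local] Existing Instance germ_filter.

Lemma base_near u g : smM (base u) g -> germ_nbhs gT u (fun v => smM (base v) g).
Proof.
move=> Sg c z cz zu; have [bu _] := mkslit_coord zu; rewrite bu in Sg.
apply: filterS (smM_near cz.1 Sg) => w Sgw q wq.
by have [-> _] := mkslit_coord wq.
Qed.

Definition crd_row c (D : operator R M) : 'rV[R]_n := \row_j D (fun q => crd c q 0 j).

(** A nonzero derivation is itself a point of [slit], hence lies in some chart by [cov], and the
    change of charts brings it into c. Its components are then read off by evaluating on the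
    coordinate functions. *)
Lemma tangent_coord c p (D : operator R M) : dom c p -> tangent (@smM R n M) p D ->
  D = coord_op c (crd c p) (crd_row c D).
Proof.
move=> cp tD; have [->|nD] := eqVneq D 0.
  rewrite (_ : crd_row c 0 = 0) ?coord_op0 //.
  by apply/rowP => j; rewrite !mxE.
have [u Du] := mkslit_def tD nD; have [c0 [z0 [cz0 zu0]]] := cov u.
have uE : val (val u) = (p, D) by apply/mkslitP.
have bu : base u = p by rewrite /base uE.
have vu : vec u = D by rewrite /vec uE.
have c0u : dom c (base u) by rewrite bu.
have [z [cz zu]] := slit_recoord cz0 zu0 c0u.
have [bz vz] := mkslit_coord zu; have [_ xE] := cod_par cz.1.
rewrite -bz bu in xE; rewrite -[LHS]vu vz xE; congr coord_op.
by apply/rowP => j; rewrite [RHS]mxE -vu vz coord_op_crd //; exact: cz.1.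
Qed.

Lemma gamma_line X c z u (t : R) : pi_vector_field X -> slit_cod c z ->
  mkslit (coord_vec c z) = Some u ->
  (base u, vec u + t *: X u) = coord_vec c (z + t *: row_mx 0 (crd_row c (X u))).
Proof.
move=> [tX _] cz zu; have [bu vu] := mkslit_coord zu; have [cp xE] := cod_par cz.1.
rewrite coord_vecE linearD linearZ /= row_mxKl scaler0 addr0.
rewrite linearD linearZ /= row_mxKr coord_op_lin -bu -vu.
congr (_, _ + _ *: _); rewrite {1}(tangent_coord (c := c) _ (tX u)) bu ?xE //.
Qed.

(** The lift is X^j d/dy^j: in coordinates the line [u + t X u] moves only the last n coordinates,
    so the chain rule along it keeps only the partials of index [rshift n j]. *)
Lemma gammaE X c z u f : pi_vector_field X -> slit_cod c z ->
  mkslit (coord_vec c z) = Some u -> smT u f ->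
  gamma X u f = \sum_j X u (fun q => crd c q 0 j) * partial (rshift n j) (local_rep c f) z.
Proof.
move=> pX cz zu Sf; rewrite /gamma /restrict_op asboolT //.
under [X in derive1 X]eq_fun do rewrite (gamma_line _ pX cz zu).
have [_ E] := smooth_at_chain (row_mx 0 (crd_row c (X u))) (smT_rep cz zu Sf).
rewrite derive1E.
have sumS (F : 'I_(n + n) -> R) :
    \sum_j F j = \sum_j F (lshift n j) + \sum_j F (rshift n j) by exact: big_split_ord.
apply: etrans E _; apply: etrans (sumS _) _.
rewrite [X in X + _]big1 ?add0r.
  by apply: eq_bigr => j _; rewrite row_mxEr mxE.
by move=> j _; rewrite row_mxEl mxE mul0r.
Qed.

Lemma gamma_vf X : pi_vector_field X -> vector_field (@smT R n M) (gamma X).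
Proof.
move=> pX; split=> [u|u f Sf].
  have [c [z [cz zu]]] := cov u.
  have dr f j : smT u f -> derivable (local_rep c f) z (delta_mx 0 j).
    by move=> Sf; exact: smooth_at_derivable (smT_rep cz zu Sf).
  split=> [a f g Sf Sg|f g Sf Sg|f nSf].
  - rewrite !(gammaE pX cz zu) //; last first.
      by apply: (germ_add gT) => //; exact: (germ_scale gT).
    rewrite mulr_sumr -big_split; apply: eq_bigr => j _ /=.
    rewrite (_ : local_rep c _ = fun w => a * local_rep c f w + local_rep c g w).
      by rewrite (partial_lin a (dr _ _ Sf) (dr _ _ Sg)); ring.
    by apply/funext => w; rewrite /local_rep; case: mkslit => //=; rewrite mulr0 addr0.
  - rewrite !(gammaE pX cz zu) //; last exact: (germ_mul gT).
    rewrite !mulr_sumr -big_split; apply: eq_bigr => j _ /=.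
    rewrite (_ : local_rep c _ = fun w => local_rep c f w * local_rep c g w).
      rewrite (partial_mul (dr _ _ Sf) (dr _ _ Sg)) /local_rep zu /=; ring.
    by apply/funext => w; rewrite /local_rep; case: mkslit => //=; rewrite mulr0.
  - by rewrite /gamma /restrict_op asboolF.
apply: rep_smT => c z cz zu.
apply: (@smooth_at_eq _ _ _ (fun w => \sum_j local_rep c (fun v => X v (fun q => crd c q 0 j)) w
    * partial (rshift n j) (local_rep c f) w)).
  apply: smooth_at_sum => j; apply: smooth_atM.
    apply: (smT_rep cz zu); apply: pX.2; apply: crd_smooth.
    by have [-> _] := mkslit_coord zu; have [] := cod_par cz.1.
  apply: smooth_at_partial; exact: smT_rep zu Sf.
near=> w; have cw : slit_cod c w by near: w; exact: slit_cod_near.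
have Sfw : forall q, mkslit (coord_vec c w) = Some q -> smT q f.
  by near: w; exact: (germ_open gT Sf).
have [q wq] := slit_chart cw; rewrite {3}/local_rep wq /= /act (gammaE pX cw wq); last exact: Sfw.
by apply: eq_bigr => j _; rewrite {1}/local_rep wq.
Unshelve. all: by end_near. Qed.

Lemma gamma_defined X u : pi_vector_field X ->
  \forall t \near (0 : R), exists q, mkslit (base u, vec u + t *: X u) = Some q.
Proof.
move=> pX; have [c [z [cz zu]]] := cov u.
have cl : z + t *: row_mx 0 (crd_row c (X u)) @[t --> (0 : R)] --> z.
  have -> : nbhs z = nbhs (z + 0 *: row_mx 0 (crd_row c (X u))).
    by rewrite scale0r addr0.
  apply: (@cvgD _ _ _ (nbhs (0 : R)) _ (fun=> z)); first exact: cvg_cst.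
  exact: cvgZr_tmp.
have near0 : \forall t \near (0 : R), slit_cod c (z + t *: row_mx 0 (crd_row c (X u))).
  exact: cl (slit_cod_near cz).
apply: filterS near0 => t /slit_chart[q tq].
by exists q; rewrite (gamma_line t pX cz zu).
Qed.

(** The lift is computed from a formula for f along the line instead of from charts. The restriction
    [-1 < t] is there for homogeneous functions, where [u + t u] has to be a positive multiple of
    u. *)
Lemma gamma_near X u f (h : R -> R) (l : R) : pi_vector_field X -> smT u f ->
  (forall t q, val (val q) = (base u, vec u + t *: X u) -> -1 < t -> f q = h t) ->
  is_derive (0 : R) (1 : R) h l -> gamma X u f = l.
Proof.
move=> pX Sf fh [_ <-]; rewrite /gamma /restrict_op asboolT // derive1E.
apply: near_eq_derive; near=> t.
have [q tq] : exists q, mkslit (base u, vec u + t *: X u) = Some q.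
  by near: t; exact: gamma_defined.
rewrite tq /=; apply: fh; first exact/mkslitP.
by near: t; apply: lt_nbhsr; rewrite ltrN10.
Unshelve. all: by end_near. Qed.

Lemma gamma_base X u g : pi_vector_field X -> smM (base u) g ->
  gamma X u (g \o base (M := M)) = 0.
Proof.
move=> pX Sg; apply: (gamma_near pX (h := fun=> g (base u))).
- exact: base_smooth.
- by move=> t q qE _; rewrite /= {1}/base qE.
Qed.

Lemma is_derive_affine (a b : R) : is_derive (0 : R) 1 (fun t : R => a + t * b) b.
Proof.
apply: is_derive_cvg.
apply: (@cvg_trans _ ((fun=> b) @ (0 : R)^')); last exact: cvg_cst.
apply: near_eq_cvg; near=> h.
rewrite mul0r addr0 [_ + 0]addr0 [_%:A]mulr1 [a + _]addrC addrK.
rewrite -[RHS]/(h^-1 * (h * b)) mulKf //.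
by near: h; exact: nbhs_dnbhs_neq.
Unshelve. all: by end_near. Qed.

Lemma gamma_vec X u g : pi_vector_field X -> smM (base u) g ->
  gamma X u (fun v => vec v g) = X u g.
Proof.
move=> pX Sg; apply: (gamma_near pX (h := fun t => vec u g + t * X u g)).
- exact: vec_smooth.
- by move=> t q qE _; rewrite /= {1}/vec qE.
- exact: is_derive_affine.
Qed.

(** Euler's relation: along the ray [(1 + t) u] the function is affine in t, with slope its value at
    u. *)
Lemma liouville_homogeneous (f : TM M -> R) u : homogeneous1 f -> smT u (restr f) ->
  liouville u (restr f) = restr f u.
Proof.
move=> hf Sf.
apply: (gamma_near (@eta_pi _ _ M) (h := fun t => restr f u + t * restr f u)) => //.
  move=> t q qE t1; rewrite /restr (hf (val u) (val q) (1 + t)).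
  - by rewrite mulrDl mul1r.
  - by lra.
  - by rewrite qE /base /eta /vec scalerDl scale1r.
exact: is_derive_affine.
Qed.

End VerticalLift.

(** * Brackets, the vertical lift and rho *)

Section FieldAlgebra.
Context {R : realType} {T B : Type}.
Implicit Types (X Y : T -> operator R B) (f : T -> R).

Lemma fieldD X Y u g : (X + Y) u g = X u g + Y u g. Proof. by []. Qed.
Lemma fieldN X u g : (- X) u g = - X u g. Proof. by []. Qed.
Lemma fieldB X Y u g : (X - Y) u g = X u g - Y u g. Proof. by []. Qed.
Lemma fieldZ f X u g : (f *v X) u g = f u * X u g. Proof. by []. Qed.
Lemma field0 u g : (0 : T -> operator R B) u g = 0. Proof. by []. Qed.
Definition fieldE := (fieldD, fieldN, fieldZ, field0).

Lemma field_ext X Y : (forall u g, X u g = Y u g) -> X = Y.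
Proof. by move=> XY; apply/funext => u; apply/funext => g. Qed.

Lemma scale1_field X : (fun=> 1) *v X = X.
Proof. by apply: field_ext => u g; rewrite fieldZ mul1r. Qed.

Lemma scaleN1_field X : (fun=> -1) *v X = - X.
Proof. by apply: field_ext => u g; rewrite fieldZ mulN1r. Qed.

End FieldAlgebra.

(* [ring] and [lra] compare atoms up to conversion, which is very slow on the
   values of vector fields; they are first replaced by variables. *)
Ltac generalize_values :=
  cbv beta;
  repeat match goal with |- context [act ?A ?f ?u] =>
    change (act A f u) with (A u f) end;
  repeat match goal with |- context [?f ?x] =>
    let t := type of (f x) in
    lazymatch t with Real.sort _ => generalize (f x) end
  end; intros.

Section BracketRules.
Context {R : realType} {T : Type} {S : T -> set (T -> R)} (gS : germ_structure S).
Local Notation N := (germ_nbhs gS).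
Local Notation vf := (vector_field S).
Local Notation br := (bracket S).
#[local] Existing Instance germ_filter.
Implicit Types (X Y Z : field R T) (f : T -> R).

Lemma act_local X u f g : vf X -> S u f -> N u (fun q => f q = g q) -> X u f = X u g.
Proof. by move=> vX Sf fg; exact: (tangent_local (vf_tangent u vX) Sf fg). Qed.

Lemma act_bracket X Y Z u f : vf X -> vf Y -> vf Z -> S u f ->
  X u (act (br Y Z) f) = X u (act Y (act Z f)) - X u (act Z (act Y f)).
Proof.
move=> vX vY vZ Sf; rewrite (act_local vX _ (bracket_near gS Y Z Sf)); last first.
  exact: vf_act (bracket_vf gS vY vZ) Sf.
by rewrite (tangent_sub gS (vf_tangent u vX) (vf_act vY (vf_act vZ Sf))
  (vf_act vZ (vf_act vY Sf))).
Qed.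

Lemma bracketC X Y : br X Y = - br Y X.
Proof.
apply: field_ext => u f; rewrite fieldN /bracket /restrict_op.
by case: ifP => _; rewrite ?oppr0 ?opprB.
Qed.

Lemma bracket0l X : vf X -> br 0 X = 0.
Proof.
move=> vX; apply: (vf_ext (bracket_vf gS (vf0 gS) vX) (vf0 gS)) => u f Sf.
rewrite bracketE // !fieldE /act (_ : (fun p => _) = fun=> 0) ?sub0r //.
by rewrite (tangent0 gS (vf_tangent u vX)) oppr0.
Qed.

Lemma bracket_linl f X Y Z : smooth S f -> vf X -> vf Y -> vf Z ->
  br (f *v X + Y) Z = f *v br X Z + br Y Z - act Z f *v X.
Proof.
move=> Sf vX vY vZ; have vfX := vf_scale gS Sf vX.
apply: vf_ext => [||u g Sg].
- by apply: (bracket_vf gS) => //; exact: (vfD gS).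
- apply: (vfB gS); first by apply: (vf_scaleD gS) => //; exact: (bracket_vf gS).
  by apply: (vf_scale gS) => // u; exact: vf_act.
have tZ := vf_tangent u vZ; have SXg := vf_act vX Sg; have SYg := vf_act vY Sg.
rewrite !fieldE !bracketE //.
rewrite -[act (f *v X + Y) g]/(fun q => f q * act X g q + act Y g q).
rewrite (tangent_add tZ) //; last exact: (germ_mul gS).
by rewrite (tangent_mul tZ) // !fieldE /act; ring.
Qed.

Lemma bracketDl X Y Z : vf X -> vf Y -> vf Z -> br (X + Y) Z = br X Z + br Y Z.
Proof.
move=> vX vY vZ; rewrite -{1}[X]scale1_field bracket_linl //.
  apply: field_ext => u f; rewrite !fieldE /act.
  by rewrite (tangent_cst gS (vf_tangent u vZ)); ring.
by move=> u; exact: (germ_cst gS).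
Qed.

Lemma bracketNl X Y : vf X -> vf Y -> br (- X) Y = - br X Y.
Proof.
move=> vX vY; rewrite -[- X]scaleN1_field -[_ *v _]addr0 bracket_linl //.
- rewrite bracket0l //; apply: field_ext => u f; rewrite !fieldE /act.
  by rewrite (tangent_cst gS (vf_tangent u vY)); ring.
- by move=> u; exact: (germ_cst gS).
- exact: (vf0 gS).
Qed.

Lemma bracketBl X Y Z : vf X -> vf Y -> vf Z -> br (X - Y) Z = br X Z - br Y Z.
Proof. by move=> vX vY vZ; rewrite bracketDl ?bracketNl //; exact: (vfN gS). Qed.

Lemma bracketBr X Y Z : vf X -> vf Y -> vf Z -> br Z (X - Y) = br Z X - br Z Y.
Proof.
by move=> vX vY vZ; rewrite bracketC bracketBl // opprB [br Z X]bracketC [br Z Y]bracketC opprK addrC.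
Qed.

Lemma jacobi X Y Z : vf X -> vf Y -> vf Z ->
  br X (br Y Z) - br Y (br X Z) = br (br X Y) Z.
Proof.
move=> vX vY vZ; have vb A B : vf A -> vf B -> vf (br A B) by exact: (bracket_vf gS).
have vYZ := vb _ _ vY vZ; have vXZ := vb _ _ vX vZ; have vXY := vb _ _ vX vY.
apply: (vf_ext (vfB gS (vb _ _ vX vYZ) (vb _ _ vY vXZ)) (vb _ _ vXY vZ)) => u f Sf.
have SXf := vf_act vX Sf; have SYf := vf_act vY Sf; have SZf := vf_act vZ Sf.
by rewrite !fieldE !bracketE // !(act_bracket _ _ _ Sf) //; ring.
Qed.

End BracketRules.

Section PiFields.
Context {R : realType} {n : nat} (M : manifold R n).
Hypothesis cov :
  forall u : slit M, exists c z, slit_cod c z /\ mkslit (coord_vec c z) = Some u.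
Local Notation gT := (gT cov).
Local Notation pvf := (@pi_vector_field R n M).
Local Notation vf := (vector_field (@smT R n M)).
Local Notation br := (bracket (@smT R n M)).
#[local] Existing Instance germ_filter.
Implicit Types (X Y Z : pifield M) (A B : field R (slit M)) (f : slit M -> R).

Lemma pvf_scaleD f X Y : smooth (@smT R n M) f -> pvf X -> pvf Y -> pvf (f *v X + Y).
Proof.
move=> Sf [tX sX] [tY sY]; split=> [u|u g Sg]; first exact: tangentZD.
apply: (germ_add gT); last exact: sY.
by apply: (germ_mul gT); [exact: Sf | exact: sX].
Qed.

Lemma pvf0 : pvf 0.
Proof. by split=> [u|u g Sg]; [exact: tangent_zero | exact: (germ_cst gT)]. Qed.

Lemma pvf_scale f X : smooth (@smT R n M) f -> pvf X -> pvf (f *v X).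
Proof. by move=> Sf pX; rewrite -[_ *v _]addr0; apply: pvf_scaleD => //; exact: pvf0. Qed.

Lemma smooth_cst (a : R) : smooth (@smT R n M) (fun=> a).
Proof. by move=> u; exact: (germ_cst gT). Qed.

Lemma pvfD X Y : pvf X -> pvf Y -> pvf (X + Y).
Proof.
by move=> pX pY; rewrite -[X]scale1_field; apply: pvf_scaleD => //; exact: smooth_cst.
Qed.

Lemma pvfN X : pvf X -> pvf (- X).
Proof. by move=> pX; rewrite -scaleN1_field; apply: pvf_scale => //; exact: smooth_cst. Qed.

Lemma pvfB X Y : pvf X -> pvf Y -> pvf (X - Y).
Proof. by move=> pX pY; apply: pvfD => //; exact: pvfN. Qed.

Lemma pvf_ext X Y : pvf X -> pvf Y ->
  (forall u g, smM (base u) g -> X u g = Y u g) -> X = Y.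
Proof.
move=> [tX _] [tY _] XY; apply: field_ext => u g.
have [Sg|nSg] := pselect (smM (base u) g); first exact: XY.
by have [_ _ zX] := tX u; have [_ _ zY] := tY u; rewrite zX // zY.
Qed.

Lemma rhoE A u g : smM (base u) g -> rho A u g = A u (g \o base (M := M)).
Proof. by move=> Sg; rewrite /rho /restrict_op asboolT. Qed.

Lemma rho_pi A : vf A -> pvf (rho A).
Proof.
move=> vA; split=> [u|u g Sg].
  have tA := vf_tangent u vA; apply: (restrict_op_tangent (gM M)) => [a f g Sf Sg|f g Sf Sg].
    by have [l _ _] := tA; rewrite -l //; exact: base_smooth.
  by rewrite -[X in _ = X + _]/((f \o base (M := M)) u * _) -(tangent_mul tA) //; exact: base_smooth.
have SA := vf_act vA (base_smooth Sg).
by apply: (germ_eq SA); apply: filterS (base_near cov Sg) => v Sgv; rewrite rhoE.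
Qed.

Lemma rho_lin f A B : rho (f *v A + B) = f *v rho A + rho B.
Proof.
apply: field_ext => u g; rewrite !fieldE /rho /restrict_op.
by case: ifP => _; rewrite ?fieldE // mulr0 addr0.
Qed.

Lemma rho0 : rho (0 : field R (slit M)) = 0.
Proof. by apply: field_ext => u g; rewrite /rho /restrict_op; case: ifP. Qed.

Lemma rhoD A B : rho (A + B) = rho A + rho B.
Proof. by rewrite -{1}[A]scale1_field rho_lin scale1_field. Qed.

Lemma rhoN A : rho (- A) = - rho A.
Proof. by rewrite -scaleN1_field -[_ *v _]addr0 rho_lin rho0 addr0 scaleN1_field. Qed.

Lemma rhoB A B : rho (A - B) = rho A - rho B.
Proof. by rewrite rhoD rhoN. Qed.

Lemma rho_gamma X : pvf X -> rho (gamma X) = 0.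
Proof.
move=> pX; apply: (pvf_ext (rho_pi (gamma_vf cov pX)) pvf0) => u g Sg.
by rewrite rhoE // (gamma_base cov).
Qed.

Lemma gamma_lin f X Y : smooth (@smT R n M) f -> pvf X -> pvf Y ->
  gamma (f *v X + Y) = f *v gamma X + gamma Y.
Proof.
move=> Sf pX pY; have pXY := pvf_scaleD Sf pX pY.
apply: vf_ext => [||u g Sg]; first exact: gamma_vf.
  by apply: (vf_scaleD gT) => //; exact: gamma_vf.
have [c [z [cz zu]]] := cov u.
rewrite !fieldE !(gammaE cov _ cz zu) // mulr_sumr -big_split.
by apply: eq_bigr => j _; rewrite /= !fieldE; ring.
Qed.

Lemma gamma_inj X Y : pvf X -> pvf Y -> gamma X = gamma Y -> X = Y.
Proof.
move=> pX pY XY; apply: pvf_ext => // u g Sg.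
by rewrite -(gamma_vec cov pX) // XY (gamma_vec cov).
Qed.

Lemma gamma0 : gamma (0 : pifield M) = 0.
Proof.
have := gamma_lin (smooth_cst (-1)) pvf0 pvf0; rewrite addr0 scaleN1_field oppr0.
by rewrite scaleN1_field addNr.
Qed.

Lemma gammaD X Y : pvf X -> pvf Y -> gamma (X + Y) = gamma X + gamma Y.
Proof.
by move=> pX pY; rewrite -{1}[X]scale1_field gamma_lin ?scale1_field //; exact: smooth_cst.
Qed.

Lemma gammaN X : pvf X -> gamma (- X) = - gamma X.
Proof.
move=> pX; rewrite -scaleN1_field -[_ *v _]addr0 gamma_lin ?gamma0 ?addr0 ?scaleN1_field //.
- exact: smooth_cst.
- exact: pvf0.
Qed.

Lemma gammaB X Y : pvf X -> pvf Y -> gamma (X - Y) = gamma X - gamma Y.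
Proof. by move=> pX pY; rewrite gammaD ?gammaN //; exact: pvfN. Qed.

(* Test functions g o pi are killed by vertical vectors; on a bracket with a
   vertical field only the first term survives. *)
Lemma rho_bracket_gamma X A u g : pvf X -> vf A -> smM (base u) g ->
  rho (br (gamma X) A) u g = gamma X u (act A (g \o base (M := M))).
Proof.
move=> pX vA Sg; have Sb := base_smooth Sg; rewrite rhoE // bracketE //.
rewrite -[X in _ - X](@act_local _ _ _ gT A u (fun=> 0)) //.
- by rewrite (tangent_cst gT (vf_tangent u vA)) subr0.
- exact: (germ_cst gT).
- by apply: filterS (base_near cov Sg) => v Sgv; rewrite /act (gamma_base cov).
Qed.

End PiFields.

(** * The Berwald connection *)

(* At a point covered by no chart every function is smooth, so every derivation
   vanishes there; this contradicts rho o beta = id on the nonzero vector eta. *)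
Lemma slit_cover (R : realType) (n : nat) (M : manifold R n) (L : TM M -> R)
    (F : finsler_objects L) (u : slit M) :
  exists c z, slit_cod c z /\ mkslit (coord_vec c z) = Some u.
Proof.
apply: contrapT => ncov.
have Su (f : slit M -> R) : smT u f by move=> c z cz zu; case: ncov; exists c, z.
have [[tb _] _ rb] := hmapP F (@eta_pi _ _ M).
have [l m _] := tb u; set D := hmap F eta u in l m.
have D1 : D (fun=> 1) = 0.
  have := m _ _ (Su (fun=> 1)) (Su (fun=> 1)).
  under eq_fun do rewrite mulr1; rewrite mul1r => /eqP.
  by rewrite -subr_eq0 opprD addNKr oppr_eq0 => /eqP.
have D0 f : D f = 0.
  (* With [h] the indicator of the complement of u, [f - f u] equals its own product with [h]. Both
     factors vanish at u, so the Leibniz rule gives 0; no regularity is required since every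
     function is smooth at u. *)
  pose h (v : slit M) : R := if `[< v = u >] then 0 else 1.
  have hu : h u = 0 by rewrite /h asboolT.
  pose k v := f v - f u.
  have -> : f = (fun v => f u * 1 + k v * h v).
    apply/funext => v; rewrite /k /h; case: asboolP => [->|_].
      by rewrite subrr mulr1 mul0r addr0.
    by rewrite !mulr1 addrC subrK.
  rewrite (l (f u) (fun=> 1) (fun v => k v * h v)) // m // D1 hu /k subrr.
  by rewrite !mul0r mulr0 !addr0.
have : vec u = 0.
  apply/funext => g; rewrite -[vec u]/(eta u) -rb /rho /restrict_op.
  by case: ifP => // _; exact: D0.
by move/eqP; rewrite (negbTE (valP u)).
Qed.

Section Objects.
Context {R : realType} {n : nat} (M : manifold R n) (L : TM M -> R) (F : finsler_objects L).
Local Notation gT := (gT (slit_cover F)).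
Local Notation cov := (slit_cover F).
Local Notation pvf := (@pi_vector_field R n M).
Local Notation vf := (vector_field (@smT R n M)).
Local Notation br := (bracket (@smT R n M)).
Local Notation G := (spray F).
Local Notation beta := (hmap F).
Local Notation K := (kmap F).
Local Notation D := (berwald F).
Local Notation bs := (base (M := M)).
#[local] Existing Instance germ_filter.
Implicit Types (X Y Z W : pifield M) (A B : field R (slit M)) (f : slit M -> R).

Definition lift_fun (g : M -> R) : slit M -> R := fun v => vec v g.

Lemma spray_vf : vf G. Proof. by case: (sprayP F). Qed.
Lemma beta_vf X : pvf X -> vf (beta X). Proof. by move=> /(hmapP F)[]. Qed.
Lemma rho_beta X : pvf X -> rho (beta X) = X. Proof. by move=> /(hmapP F)[]. Qed.
Lemma connector_pi A : vf A -> pvf (K A). Proof. by move=> /(kmapP F)[]. Qed.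
Lemma gamma_connector A : vf A -> gamma (K A) = vproj G A.
Proof. by move=> /(kmapP F)[]. Qed.
Lemma br_vf A B : vf A -> vf B -> vf (br A B). Proof. exact: (bracket_vf gT). Qed.

(** Exactness of the sequence in the middle, drawn from the connector instead of charts. If
    [rho A = 0] then [J A = 0], so [gamma (K A) = vproj G A] is half of [A + J [A, G]]; solving for
    A gives the witness 2 K A - rho [A, G]. *)
Lemma vertical_gamma A : vf A -> rho A = 0 -> exists2 W, pvf W & A = gamma W.
Proof.
move=> vA rA; have vAG := br_vf vA spray_vf; have vG := spray_vf.
have pK := connector_pi vA; have pr := rho_pi cov vAG.
exists ((fun=> 2) *v K A - rho (br A G)).
  by apply: (pvfD cov); [apply: (pvf_scale cov) => //; exact: (smooth_cst cov)|exact: (pvfN cov)].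
rewrite (gamma_lin cov) ?(gammaN cov) //; [|exact: (smooth_cst cov)|exact: (pvfN cov)].
rewrite gamma_connector //; apply: field_ext => u f; rewrite !fieldE.
rewrite -[vproj G A u f]/(2^-1 * (A u f - (br (J A) G u f - J (br A G) u f))).
rewrite /J rA (gamma0 cov) (bracket0l gT) // field0.
by rewrite sub0r opprK mulrA divff ?pnatr_eq0 // mul1r addrK.
Qed.

(** * Splitting, connector and Berwald calculus of a semispray *)

Section Semispray.
(** Assumed here so that the section serves both sprays: the first obtains it from the nondegeneracy
    of dd_J E ([spray_semispray]), the second from the first, as they differ by a vertical field
    ([semispray_projective]). *)
Hypothesis semispray : rho G = eta.

Lemma spray_base u g : smM (base u) g -> G u (g \o bs) = vec u g.
Proof. by move=> Sg; rewrite -rhoE // semispray. Qed.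

Lemma spray_base_near u g : smM (base u) g ->
  germ_nbhs gT u (fun v => act G (g \o bs) v = lift_fun g v).
Proof. by move=> Sg; apply: filterS (base_near cov Sg) => v; exact: spray_base. Qed.

(** Evaluate [gamma (K A) = vproj G A] on u(g). By the semispray identity both [J A, G] and J [A, G]
    produce the second-order term G(A(g o pi)), and these cancel; what is left involves G only
    through the function G(u(g)). *)
Lemma connectorE A u g : vf A -> smM (base u) g ->
  K A u g = A u (lift_fun g) - 2^-1 * gamma (rho A) u (act G (lift_fun g)).
Proof.
move=> vA Sg; have vG := spray_vf; have Sl := vec_smooth Sg; have Sb := base_smooth Sg.
have pr := rho_pi cov vA; have vJ := gamma_vf cov pr.
rewrite -(gamma_vec cov (connector_pi vA) Sg) gamma_connector //.
rewrite -[vproj G A u _]/(2^-1 * (A u (lift_fun g) -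
  (br (J A) G u (lift_fun g) - J (br A G) u (lift_fun g)))).
have -> : J (br A G) u (lift_fun g) = A u (lift_fun g) - G u (act A (g \o bs)).
  rewrite /J (gamma_vec cov) //; last exact: (rho_pi cov (br_vf vA vG)).
  rewrite rhoE // bracketE // (act_local vA _ (spray_base_near Sg)) //.
  exact: vf_act vG Sb.
have -> : br (J A) G u (lift_fun g) = gamma (rho A) u (act G (lift_fun g)) -
    G u (act A (g \o bs)).
  rewrite /J bracketE //; congr (_ - _).
  apply: (act_local (gS := gT) vG); first exact: vf_act vJ Sl.
  apply: filterS (base_near cov Sg) => v Sgv.
  by rewrite /act (gamma_vec cov) // rhoE.
by field.
Qed.

Lemma connector_lin f A B : smooth (@smT R n M) f -> vf A -> vf B ->
  K (f *v A + B) = f *v K A + K B.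
Proof.
move=> Sf vA vB; have vAB := vf_scaleD gT Sf vA vB.
apply: (pvf_ext (connector_pi vAB)) => [|u g Sg].
  exact: (pvf_scaleD cov Sf (connector_pi vA) (connector_pi vB)).
rewrite connectorE // rho_lin (gamma_lin cov) //; try exact: (rho_pi cov).
by rewrite !fieldE !connectorE //; generalize_values; ring.
Qed.

Lemma connectorD A B : vf A -> vf B -> K (A + B) = K A + K B.
Proof.
move=> vA vB; rewrite -{1}[A]scale1_field connector_lin ?scale1_field //.
exact: (smooth_cst cov).
Qed.

Lemma connectorN A : vf A -> K (- A) = - K A.
Proof.
move=> vA; have v0 := vf0 gT; have vN := vfN gT vA.
have K0 : K 0 = 0.
  by have /eqP := connectorD v0 v0; rewrite addr0 -subr_eq0 opprD addNKr oppr_eq0 => /eqP.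
by apply/eqP; rewrite -addr_eq0 -connectorD // addNr K0.
Qed.

Lemma connectorB A B : vf A -> vf B -> K (A - B) = K A - K B.
Proof. by move=> vA vB; rewrite connectorD ?connectorN //; exact: (vfN gT). Qed.

Lemma connector_gamma W : pvf W -> K (gamma W) = W.
Proof.
move=> pW; have vW := gamma_vf cov pW.
apply: (pvf_ext (connector_pi vW) pW) => u g Sg.
by rewrite connectorE // (rho_gamma cov) // (gamma0 cov) field0 mulr0 subr0 (gamma_vec cov).
Qed.

(** Since h + v is the identity, [beta X = hproj G Z] is [Z - gamma (K Z)], and K is a left inverse
    of gamma. *)
Lemma connector_beta X : pvf X -> K (beta X) = 0.
Proof.
move=> pX; have [vb [Z vZ bE] _] := hmapP F pX.
have -> : beta X = Z - gamma (K Z).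
  rewrite gamma_connector // bE; apply: field_ext => u f; rewrite !fieldE.
  rewrite -[hproj G Z u f]/(2^-1 * (Z u f + barthel G Z u f)).
  rewrite -[vproj G Z u f]/(2^-1 * (Z u f - barthel G Z u f)).
  by field.
have pK := connector_pi vZ.
by rewrite connectorB ?connector_gamma ?subrr //; exact: (gamma_vf cov).
Qed.

(** [A - beta (rho A)] is killed by rho, hence is a lift [gamma W]; applying K identifies W with
    [K A]. *)
Lemma horizontal_vertical A : vf A -> A = gamma (K A) + beta (rho A).
Proof.
move=> vA; have pr := rho_pi cov vA; have vb := beta_vf pr.
have [|W pW WE] := vertical_gamma (vfB gT vA vb).
  by rewrite rhoB rho_beta // subrr.
have : K (A - beta (rho A)) = W by rewrite WE connector_gamma.
rewrite connectorB // connector_beta // subr0 => ->.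
by rewrite -WE subrK.
Qed.

(** [horizontal_map] does not postulate any linearity of beta; it is read off from the splitting of
    [- beta X]. *)
Lemma betaN X : pvf X -> beta (- X) = - beta X.
Proof.
move=> pX; have vX := beta_vf pX; have pN := pvfN cov pX.
rewrite [RHS]horizontal_vertical; last exact: (vfN gT).
by rewrite connectorN // connector_beta // oppr0 (gamma0 cov) add0r rhoN rho_beta.
Qed.

(** For G = y^i d/dx^i - 2 G^i d/dy^i this is the classical formula N^i_j = dG^i/dy^j for the
    coefficients of the nonlinear connection. *)
Lemma beta_vec X u g : pvf X -> smM (base u) g ->
  beta X u (lift_fun g) = 2^-1 * gamma X u (act G (lift_fun g)).
Proof.
move=> pX Sg; have := connectorE (beta_vf pX) Sg.
by rewrite connector_beta // rho_beta // => /esym/subr0_eq.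
Qed.

Lemma berwald_pi A Y : vf A -> pvf Y -> pvf (D A Y).
Proof. by have [[pD _ _ _] _] := berwaldP F; exact: pD. Qed.

Lemma berwald_linl f A B Y : smooth (@smT R n M) f -> vf A -> vf B -> pvf Y ->
  D (f *v A + B) Y = f *v D A Y + D B Y.
Proof. by have [[_ lD _ _] _] := berwaldP F; exact: lD. Qed.

Lemma berwaldDl A B Y : vf A -> vf B -> pvf Y -> D (A + B) Y = D A Y + D B Y.
Proof.
move=> vA vB pY; rewrite -{1}[A]scale1_field berwald_linl ?scale1_field //.
exact: (smooth_cst cov).
Qed.

Lemma berwaldNl A Y : vf A -> pvf Y -> D (- A) Y = - D A Y.
Proof.
move=> vA pY; have v0 := vf0 gT; have vN := vfN gT vA.
have D0 : D 0 Y = 0.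
  by have /eqP := berwaldDl v0 v0 pY; rewrite addr0 -subr_eq0 opprD addNKr oppr_eq0 => /eqP.
by apply/eqP; rewrite -addr_eq0 -berwaldDl // addNr D0.
Qed.

Lemma berwaldBl A B Y : vf A -> vf B -> pvf Y -> D (A - B) Y = D A Y - D B Y.
Proof. by move=> vA vB pY; rewrite berwaldDl ?berwaldNl //; exact: (vfN gT). Qed.

Lemma berwaldDr A X Y : vf A -> pvf X -> pvf Y -> D A (X + Y) = D A X + D A Y.
Proof. by have [[_ _ aD _] _] := berwaldP F; exact: aD. Qed.

Lemma berwaldZr f A Y : smooth (@smT R n M) f -> vf A -> pvf Y ->
  D A (f *v Y) = act A f *v Y + f *v D A Y.
Proof. by have [[_ _ _ mD] _] := berwaldP F; exact: mD. Qed.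

Lemma berwaldNr A Y : vf A -> pvf Y -> D A (- Y) = - D A Y.
Proof.
move=> vA pY; rewrite -scaleN1_field berwaldZr ?scaleN1_field //; last exact: (smooth_cst cov).
apply: field_ext => u g; rewrite !fieldE /act.
by rewrite (tangent_cst gT (vf_tangent u vA)) mul0r add0r.
Qed.

Lemma berwaldBr A X Y : vf A -> pvf X -> pvf Y -> D A (X - Y) = D A X - D A Y.
Proof. by move=> vA pX pY; rewrite berwaldDr ?berwaldNr //; exact: (pvfN cov). Qed.

Lemma berwald_gamma X Y : pvf X -> pvf Y -> D (gamma X) Y = rho (br (gamma X) (beta Y)).
Proof. by have [_ bD] := berwaldP F; move=> pX pY; have [] := bD X Y pX pY. Qed.

Lemma berwald_beta X Y : pvf X -> pvf Y -> D (beta X) Y = K (br (beta X) (gamma Y)).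
Proof. by have [_ bD] := berwaldP F; move=> pX pY; have [] := bD X Y pX pY. Qed.

Lemma beta_base_near Y u g : pvf Y -> smM (base u) g ->
  germ_nbhs gT u (fun v => act (beta Y) (g \o bs) v = Y v g).
Proof.
move=> pY Sg; apply: filterS (base_near cov Sg) => v Sgv.
by rewrite /act -rhoE // rho_beta.
Qed.

Lemma berwald_gammaE X Y u g : pvf X -> pvf Y -> smM (base u) g ->
  D (gamma X) Y u g = gamma X u (fun v => Y v g).
Proof.
move=> pX pY Sg; have vY := beta_vf pY; rewrite berwald_gamma // (rho_bracket_gamma cov) //.
apply: (act_local (gS := gT) (gamma_vf cov pX) _ (beta_base_near pY Sg)).
exact: vf_act vY (base_smooth Sg).
Qed.

Lemma gamma_gamma_near X Y u g : pvf X -> pvf Y -> smM (base u) g ->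
  germ_nbhs gT u (fun v => D (gamma X) Y v g = act (gamma X) (fun w => Y w g) v).
Proof. by move=> pX pY Sg; apply: filterS (base_near cov Sg) => v; exact: berwald_gammaE. Qed.

Lemma berwald_gamma_eta X : pvf X -> D (gamma X) eta = X.
Proof.
move=> pX; have pe := @eta_pi _ _ M; have vX := gamma_vf cov pX.
apply: (pvf_ext (berwald_pi vX pe) pX) => u g Sg.
by rewrite berwald_gammaE // (gamma_vec cov).
Qed.

(** The bracket is vertical because both fields kill the functions g o pi; its components are then
    found on the functions u(g), where each field acts by its own components. *)
Lemma bracket_gamma_gamma X Y : pvf X -> pvf Y ->
  br (gamma X) (gamma Y) = gamma (D (gamma X) Y - D (gamma Y) X).
Proof.
move=> pX pY; have vX := gamma_vf cov pX; have vY := gamma_vf cov pY.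
have vXY := br_vf vX vY.
have pW : pvf (D (gamma X) Y - D (gamma Y) X) by apply: (pvfB cov); exact: berwald_pi.
have r0 : rho (br (gamma X) (gamma Y)) = 0.
  apply: (pvf_ext (rho_pi cov vXY) (pvf0 cov)) => u g Sg.
  rewrite (rho_bracket_gamma cov) // field0.
  rewrite (@act_local _ _ _ gT _ u _ (fun=> 0)) //.
  - exact: (tangent_cst gT (vf_tangent u vX)).
  - exact: vf_act vY (base_smooth Sg).
  - by apply: filterS (base_near cov Sg) => v Sgv; rewrite /act (gamma_base cov).
have [W pW' WE] := vertical_gamma vXY r0; rewrite WE; congr gamma.
apply: (pvf_ext pW' pW) => u g Sg; have Sl := vec_smooth Sg.
have near_vec Z : pvf Z -> germ_nbhs gT u (fun v => act (gamma Z) (lift_fun g) v = Z v g).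
  move=> pZ; apply: filterS (base_near cov Sg) => v Sgv.
  by rewrite /act (gamma_vec cov).
rewrite -(gamma_vec cov pW' Sg) -WE bracketE // !fieldE !berwald_gammaE //.
rewrite (act_local vX (vf_act vY Sl) (near_vec Y pY)).
by rewrite (act_local vY (vf_act vX Sl) (near_vec X pX)).
Qed.

(** The two defining formulas of D are, up to sign, the vertical and the horizontal component of
    this bracket. *)
Lemma bracket_beta_gamma X Y : pvf X -> pvf Y ->
  br (beta X) (gamma Y) = gamma (D (beta X) Y) - beta (D (gamma Y) X).
Proof.
move=> pX pY; have vX := beta_vf pX; have vY := gamma_vf cov pY.
rewrite [LHS]horizontal_vertical; last exact: br_vf.
rewrite -berwald_beta // [br (beta X) (gamma Y)]bracketC rhoN -berwald_gamma //.
by rewrite betaN //; exact: berwald_pi.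
Qed.

Lemma berwald_betaE X Y u g : pvf X -> pvf Y -> smM (base u) g ->
  D (beta X) Y u g = beta X u (fun v => Y v g) - 2^-1 * gamma Y u (act (gamma X) (act G (lift_fun g)))
    + 2^-1 * gamma (D (gamma Y) X) u (act G (lift_fun g)).
Proof.
move=> pX pY Sg; have vX := beta_vf pX; have vY := gamma_vf cov pY.
have vgX := gamma_vf cov pX; have vG := spray_vf; have Sl := vec_smooth Sg.
have SGl := vf_act vG Sl; have pD := berwald_pi vY pX.
rewrite berwald_beta // connectorE //; last exact: br_vf.
rewrite [X in rho X]bracketC rhoN -berwald_gamma // (gammaN cov) //.
rewrite fieldN bracketE //.
rewrite (@act_local _ _ _ gT _ u _ (fun v => Y v g) vX); last first.
- apply: filterS (base_near cov Sg) => v Sgv.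
  by rewrite /act (gamma_vec cov).
- exact: vf_act vY Sl.
rewrite (@act_local _ _ _ gT _ u _ (fun v => 2^-1 * act (gamma X) (act G (lift_fun g)) v) vY); last first.
- by apply: filterS (base_near cov Sg) => v; exact: beta_vec.
- exact: vf_act vX Sl.
rewrite (tangent_scale gT (vf_tangent u vY) _ (vf_act vgX SGl)).
by ring.
Qed.

(** In [berwald_betaE] the terms containing G(u(g)) antisymmetrize to half of [gamma X, gamma Y] -
    gamma(D_{gamma X} Y - D_{gamma Y} X), which is zero: the symmetry of the second vertical
    derivatives of the spray coefficients. *)
Lemma torsion_free X Y : pvf X -> pvf Y ->
  rho (br (beta X) (beta Y)) = D (beta X) Y - D (beta Y) X.
Proof.
move=> pX pY; have vX := beta_vf pX; have vY := beta_vf pY.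
have vgX := gamma_vf cov pX; have vgY := gamma_vf cov pY; have vG := spray_vf.
have pDX := berwald_pi vX pY; have pDY := berwald_pi vY pX.
have pXY := berwald_pi vgX pY; have pYX := berwald_pi vgY pX.
apply: (pvf_ext (rho_pi cov (br_vf vX vY)) (pvfB cov pDX pDY)) => u g Sg.
have Sb := base_smooth Sg; have SGl := vf_act vG (vec_smooth Sg).
rewrite rhoE // bracketE // !fieldE !berwald_betaE //.
rewrite (act_local vX (vf_act vY Sb) (beta_base_near pY Sg)).
rewrite (act_local vY (vf_act vX Sb) (beta_base_near pX Sg)).
have := congr1 (fun A => A u (act G (lift_fun g))) (bracket_gamma_gamma pX pY).
rewrite bracketE // (gammaB cov) // !fieldE; generalize_values; lra.
Qed.

(** The curvature of the nonlinear connection, that is the obstruction to integrability of the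
    horizontal distribution. *)
Definition horizontal_torsion X Y : pifield M := K (br (beta X) (beta Y)).

Lemma horizontal_torsion_pi X Y : pvf X -> pvf Y -> pvf (horizontal_torsion X Y).
Proof. by move=> pX pY; apply: connector_pi; apply: br_vf; exact: beta_vf. Qed.

(* The Jacobi identity for beta X, beta Y, gamma Z. *)
Lemma hcurvE X Y Z : pvf X -> pvf Y -> pvf Z ->
  hcurv F X Y Z = D (gamma Z) (horizontal_torsion X Y)
    - horizontal_torsion (D (gamma Z) X) Y - horizontal_torsion X (D (gamma Z) Y).
Proof.
move=> pX pY pZ; have vX := beta_vf pX; have vY := beta_vf pY; have vZ := gamma_vf cov pZ.
have pZX := berwald_pi vZ pX; have pZY := berwald_pi vZ pY.
have vZX := beta_vf pZX; have vZY := beta_vf pZY.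
have pXZ := berwald_pi vX pZ; have pYZ := berwald_pi vY pZ.
have vgXZ := gamma_vf cov pXZ; have vgYZ := gamma_vf cov pYZ.
have vXY := br_vf vX vY; have pr := rho_pi cov vXY; have vr := beta_vf pr.
have pO := horizontal_torsion_pi pX pY; have vO := gamma_vf cov pO.
have := congr1 K (jacobi gT vX vY vZ).
rewrite !bracket_beta_gamma // !(bracketBr gT) // [K (_ - _ - _)]connectorB; last 2 first.
- by apply: (vfB gT); exact: br_vf.
- by apply: (vfB gT); exact: br_vf.
rewrite !connectorB; try exact: br_vf.
rewrite -!berwald_beta // -[K (br (beta X) _)]/(horizontal_torsion _ _).
rewrite -[K (br (beta Y) _)]/(horizontal_torsion _ _).
(* Split [beta X, beta Y] into its two components. The bracket of its horizontal part with gamma Z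
   gives a D-derivative of Z; that of its vertical part gives another one and the term - D_{gamma Z}
   of the torsion. *)
have -> : K (br (br (beta X) (beta Y)) (gamma Z)) =
    D (br (beta X) (beta Y)) Z - D (gamma Z) (horizontal_torsion X Y).
  rewrite [in LHS](horizontal_vertical vXY) (bracketDl gT) // connectorD; try exact: br_vf.
  rewrite bracket_gamma_gamma // connector_gamma; last by apply: (pvfB cov); exact: berwald_pi.
  rewrite -berwald_beta // [in RHS](horizontal_vertical vXY) berwaldDl //.
  by apply: field_ext => u g; rewrite !fieldE; ring.
have -> : horizontal_torsion (D (gamma Z) X) Y = - horizontal_torsion Y (D (gamma Z) X).
  by rewrite /horizontal_torsion bracketC connectorN //; exact: br_vf.
move=> E; apply: field_ext => u g; have := congr1 (fun W : pifield M => W u g) E.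
by rewrite /hcurv /curvature !fieldE; generalize_values; lra.
Qed.

(** On components D_{gamma X} is the derivation gamma X, so the curvature is the commutator of two
    derivations compared with their bracket. *)
Lemma vertical_curvature0 X Y Z : pvf X -> pvf Y -> pvf Z ->
  curvature F (gamma X) (gamma Y) Z = 0.
Proof.
move=> pX pY pZ; have vX := gamma_vf cov pX; have vY := gamma_vf cov pY.
have pXZ := berwald_pi vX pZ; have pYZ := berwald_pi vY pZ.
have pXYZ := berwald_pi vX pYZ; have pYXZ := berwald_pi vY pXZ.
have pW : pvf (D (gamma X) Y - D (gamma Y) X) by apply: (pvfB cov); exact: berwald_pi.
have pBZ := berwald_pi (br_vf vX vY) pZ.
apply: (pvf_ext _ (pvf0 cov)) => [|u g Sg].
  by apply: (pvfD cov) => //; apply: (pvfD cov) => //; exact: (pvfN cov).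
have SZ : smT u (fun v => Z v g) by exact: pZ.2.
rewrite /curvature !fieldE bracket_gamma_gamma // !berwald_gammaE //.
rewrite -bracket_gamma_gamma // bracketE //.
rewrite (act_local vX (pYZ.2 _ _ Sg) (gamma_gamma_near pY pZ Sg)).
rewrite (act_local vY (pXZ.2 _ _ Sg) (gamma_gamma_near pX pZ Sg)).
by generalize_values; ring.
Qed.

End Semispray.
End Objects.

(** * Consequences of the Finsler structure *)

Section CanonicalSpray.
Context {R : realType} {n : nat} (M : manifold R n) (L : TM M -> R).
Context (hL : finsler L) (F : finsler_objects L).
Local Notation cov := (slit_cover F).
Local Notation gT := (gT cov).
Local Notation pvf := (@pi_vector_field R n M).
Local Notation vf := (vector_field (@smT R n M)).
Local Notation br := (bracket (@smT R n M)).
Local Notation G := (spray F).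
Local Notation beta := (hmap F).
Local Notation D := (berwald F).
Local Notation C := (@liouville R n M).
Local Notation E := (energy L).
#[local] Existing Instance germ_filter.
Implicit Types (X Y Z : pifield M) (A B : field R (slit M)).

Lemma liouville_vf : vf C. Proof. exact: (gamma_vf cov (@eta_pi _ _ M)). Qed.

Lemma J_vf A : vf A -> vf (J A).
Proof. by move=> vA; exact: (gamma_vf cov (rho_pi cov vA)). Qed.

Lemma JJ0 A : vf A -> J (J A) = 0.
Proof. by move=> vA; rewrite /J (rho_gamma cov) ?(gamma0 cov) //; exact: (rho_pi cov). Qed.

Lemma J_liouville : J C = 0.
Proof. by rewrite /J (rho_gamma cov) ?(gamma0 cov) //; exact: eta_pi. Qed.

Lemma JB A B : vf A -> vf B -> J (A - B) = J A - J B.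
Proof. by move=> vA vB; rewrite /J rhoB (gammaB cov) //; exact: (rho_pi cov). Qed.

Lemma rho_bracket_gammaE X A : pvf X -> vf A -> rho (br (gamma X) A) = D (gamma X) (rho A).
Proof.
move=> pX vA; have vX := gamma_vf cov pX; have pA := rho_pi cov vA.
apply: (pvf_ext (rho_pi cov (br_vf F vX vA)) (berwald_pi F vX pA)) => u g Sg.
rewrite (rho_bracket_gamma cov) // berwald_gammaE //.
apply: (act_local (gS := gT) vX (vf_act vA (base_smooth Sg))).
by apply: filterS (base_near cov Sg) => v Sgv; rewrite rhoE.
Qed.

(** Vanishing of the Nijenhuis tensor of J, given J J = 0: both sides are gamma of D_{J A} (rho B) -
    D_{J B} (rho A). *)
Lemma nijenhuis_J A B : vf A -> vf B ->
  br (J A) (J B) = J (br (J A) B) + J (br A (J B)).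
Proof.
move=> vA vB; have pA := rho_pi cov vA; have pB := rho_pi cov vB.
have vJA := J_vf vA; have vJB := J_vf vB.
rewrite /J (bracket_gamma_gamma F) // rho_bracket_gammaE // bracketC rhoN rho_bracket_gammaE //.
by rewrite (gammaB cov) ?(gammaN cov) //; exact: berwald_pi.
Qed.

(** The Lie derivative of J along C is - J; the extra term comes from D_{J B} eta = rho B. *)
Lemma bracket_liouville_J B : vf B -> br C (J B) = J (br C B) - J B.
Proof.
move=> vB; have pB := rho_pi cov vB; have pe := @eta_pi _ _ M.
have vC := liouville_vf; have vJB := J_vf vB.
rewrite /J (bracket_gamma_gamma F) // rho_bracket_gammaE // berwald_gamma_eta //.
by rewrite (gammaB cov) //; exact: berwald_pi.
Qed.

Lemma energy_smooth : smooth (@smT R n M) E.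
Proof.
have [_ sL _ _ _] := hL; move=> u; apply: (germ_scale gT).
have -> : (fun v => restr L v ^+ 2) = (fun v => restr L v * restr L v).
  by apply/funext => v; rewrite expr2.
exact: (germ_mul gT).
Qed.

Lemma liouville_energy u : C u E = 2 * E u.
Proof.
have [_ sL _ homL _] := hL; have tC := vf_tangent u liouville_vf.
have SLL : smT u (fun v => restr L v * restr L v) by exact: (germ_mul gT).
have -> : E = (fun v => 2^-1 * (restr L v * restr L v)).
  by apply/funext => v; rewrite /energy expr2.
rewrite (tangent_scale gT tC) // (tangent_mul tC) //.
by rewrite (liouville_homogeneous cov homL) //; field.
Qed.

Lemma dJ_smooth A : vf A -> smooth (@smT R n M) (dJ E A).
Proof. by move=> vA u; have SE := energy_smooth; exact: (vf_act (J_vf vA) (SE u)). Qed.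

Lemma dJ_zero A : J A = 0 -> dJ E A = fun=> 0.
Proof. by move=> JA; rewrite /dJ JA. Qed.

(** d_J E is invariant under the Lie derivative along C with weight 1: E has weight 2 by Euler's
    relation, and J has weight -1. *)
Lemma liouville_dJ B : vf B -> act C (dJ E B) = fun u => dJ E (br C B) u + dJ E B u.
Proof.
move=> vB; have vC := liouville_vf; have vJB := J_vf vB.
have SE := energy_smooth; apply/funext => u.
have := congr1 (fun A => A u E) (bracket_liouville_J vB).
rewrite bracketE // fieldB.
have -> : act C E = fun v => 2 * E v by apply/funext => v; exact: liouville_energy.
rewrite (tangent_scale gT (vf_tangent u vJB)) // /dJ /act.
by generalize_values; lra.
Qed.

Lemma ddJ_liouville B u : vf B -> ddJ E C B u = dJ E B u.
Proof.
move=> vB; rewrite /ddJ liouville_dJ // (dJ_zero J_liouville) /act.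
by rewrite (tangent0 gT (vf_tangent u vB)); generalize_values; ring.
Qed.

Lemma ddJ_J A B u : vf A -> vf B -> ddJ E (J A) B u = - ddJ E A (J B) u.
Proof.
move=> vA vB; have vJA := J_vf vA; have vJB := J_vf vB; have SE := energy_smooth.
have := congr1 (fun A => A u E) (nijenhuis_J vA vB).
rewrite bracketE // fieldD /ddJ (dJ_zero (JJ0 vA)) (dJ_zero (JJ0 vB)) /act.
rewrite (tangent0 gT (vf_tangent u vA)) (tangent0 gT (vf_tangent u vB)) /dJ /act.
by generalize_values; lra.
Qed.

Lemma ddJBl A A' B u : vf A -> vf A' -> vf B ->
  ddJ E (A - A') B u = ddJ E A B u - ddJ E A' B u.
Proof.
move=> vA vA' vB; have tB := vf_tangent u vB.
have dJB A1 A2 : vf A1 -> vf A2 -> dJ E (A1 - A2) = fun v => dJ E A1 v - dJ E A2 v.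
  by move=> v1 v2; rewrite /dJ JB.
have vAB := br_vf F vA vB; have vA'B := br_vf F vA' vB.
rewrite /ddJ (bracketBl gT) // !dJB //.
rewrite [act B (fun v => _)](_ : _ = fun v => act B (dJ E A) v - act B (dJ E A') v).
  by rewrite /act !fieldE; generalize_values; ring.
have SA := dJ_smooth vA; have SA' := dJ_smooth vA'.
by apply/funext => v; exact: (tangent_sub gT (vf_tangent v vB) (SA v) (SA' v)).
Qed.

Lemma ddJ_spray B u : vf B -> ddJ E G B u = - B u E.
Proof. by move=> vB; have [_ /(_ B vB) ->] := sprayP F. Qed.

Lemma ddJ_nondegenerate A A' : vf A -> vf A' ->
  (forall B u, vf B -> ddJ E A B u = ddJ E A' B u) -> A = A'.
Proof.
move=> vA vA' AA'; have [_ _ _ _ nd] := hL.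
apply/subr0_eq/funext => u; apply: (nd _ (vfB gT vA vA')) => B vB.
by rewrite ddJBl // AA' // subrr.
Qed.

(** For every B, dd_J E(J G, B) = - dd_J E(G, J B) = (J B) E = d_J E(B) = dd_J E(C, B).
    Nondegeneracy gives J G = C, and gamma is injective. *)
Lemma spray_semispray : rho G = eta.
Proof.
have vG := spray_vf F; have pe := @eta_pi _ _ M; have vC := liouville_vf.
apply: (gamma_inj cov (rho_pi cov vG) pe).
apply: (ddJ_nondegenerate (J_vf vG) vC) => B u vB.
by rewrite ddJ_J // ddJ_spray ?opprK ?ddJ_liouville //; exact: J_vf.
Qed.

(** The Lie derivative along C commutes with d, so dd_J E inherits weight 1 from d_J E; the
    commutation is carried out by hand with the Jacobi identity. *)
Lemma liouville_ddJ A B u : vf A -> vf B ->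
  C u (ddJ E A B) = ddJ E (br C A) B u + ddJ E A (br C B) u + ddJ E A B u.
Proof.
move=> vA vB; have vC := liouville_vf; have vCA := br_vf F vC vA; have vCB := br_vf F vC vB.
have vAB := br_vf F vA vB; have tC := vf_tangent u vC.
have SA := dJ_smooth vA; have SB := dJ_smooth vB; have SAB := dJ_smooth vAB.
have SAdB : smT u (act A (dJ E B)) by exact: vf_act vA (SB u).
have SBdA : smT u (act B (dJ E A)) by exact: vf_act vB (SA u).
have -> : C u (ddJ E A B) = C u (act A (dJ E B)) - C u (act B (dJ E A)) - C u (dJ E (br A B)).
  rewrite (tangent_sub gT tC); [|exact: (germ_sub gT)|exact: SAB].
  by rewrite (tangent_sub gT tC).
have E1 : br C A u (dJ E B) = C u (act A (dJ E B)) - A u (act C (dJ E B)) by rewrite bracketE.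
have E2 : br C B u (dJ E A) = C u (act B (dJ E A)) - B u (act C (dJ E A)) by rewrite bracketE.
have E3 : C u (dJ E (br A B)) = dJ E (br C (br A B)) u + dJ E (br A B) u.
  by rewrite -[LHS]/(act C (dJ E (br A B)) u) liouville_dJ.
have E4 : dJ E (br C (br A B)) u = dJ E (br (br C A) B) u + dJ E (br A (br C B)) u.
  have v1 := br_vf F vC vAB; have v2 := br_vf F vA vCB.
  rewrite -(jacobi gT vC vA vB) /dJ JB // /act fieldB.
  by rewrite subrK.
have [E5 E6] : A u (act C (dJ E B)) = A u (dJ E (br C B)) + A u (dJ E B) /\
    B u (act C (dJ E A)) = B u (dJ E (br C A)) + B u (dJ E A).
  rewrite !liouville_dJ // (tangent_add (vf_tangent u vA)); [|exact: dJ_smooth|exact: SB].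
  by rewrite (tangent_add (vf_tangent u vB)) //; exact: dJ_smooth.
by move: E1 E2 E3 E4 E5 E6; rewrite /ddJ /act; generalize_values; lra.
Qed.

(** Differentiate i_G dd_J E = - dE along C. The right-hand side has weight 2 and dd_J E has weight
    1, so dd_J E([C, G], B) = dd_J E(G, B) for all B, and nondegeneracy concludes. *)
Lemma bracket_liouville_spray : br C G = G.
Proof.
have vC := liouville_vf; have vG := spray_vf F; have SE := energy_smooth.
apply: (ddJ_nondegenerate (br_vf F vC vG) vG) => B u vB.
have := liouville_ddJ u vG vB; have vCB := br_vf F vC vB.
rewrite !ddJ_spray // bracketE //.
have -> : act C E = fun v => 2 * E v by apply/funext => v; exact: liouville_energy.
rewrite (tangent_scale gT (vf_tangent u vB)) //.
have -> : ddJ E G B = fun v => - act B E v by apply/funext => v; exact: ddJ_spray.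
rewrite (tangent_opp gT (vf_tangent u vC)); last exact: vf_act vB (SE u).
by rewrite /act; generalize_values; lra.
Qed.

(** By [C, G] = G the function G(u(g)) is homogeneous of degree 2 under C. Its vertical derivative
    along X then cancels between [beta_vec] and the bracket [C, gamma X]. *)
Lemma berwald_beta_eta X : pvf X -> D (beta X) eta = 0.
Proof.
move=> pX; have pe := @eta_pi _ _ M; have hG := spray_semispray.
have vX := gamma_vf cov pX; have vb := beta_vf F pX; have vC := liouville_vf.
have vG := spray_vf F; have pCX := berwald_pi F vC pX.
apply: (pvf_ext (berwald_pi F vb pe) (pvf0 cov)) => u g Sg.
have Sl := vec_smooth Sg; have SGl := vf_act vG Sl.
rewrite berwald_betaE // field0 -[gamma eta]/C.
rewrite -[fun v => eta v g]/(lift_fun g) beta_vec //.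
have E1 : gamma X u (act C (act G (lift_fun g))) = 2 * gamma X u (act G (lift_fun g)).
  rewrite -(tangent_scale gT (vf_tangent u vX)) //.
  apply: (act_local (gS := gT) vX (vf_act vC SGl)).
  apply: filterS2 (base_near cov Sg) (germ_open gT SGl) => v Sgv SGv.
  have Slv := vec_smooth Sgv.
  have := congr1 (fun A => A v (lift_fun g)) bracket_liouville_spray; rewrite bracketE //.
  rewrite (@act_local _ _ _ gT _ v _ (lift_fun g) vG (vf_act vC Slv)); last first.
    by apply: filterS (base_near cov Sgv) => w Sgw; exact: (gamma_vec cov pe Sgw).
  move=> E0; rewrite -[LHS]/(C v (act G (lift_fun g))) -[RHS]/(2 * G v (lift_fun g)).
  by move: E0; generalize_values; lra.
have := congr1 (fun A => A u (act G (lift_fun g))) (bracket_gamma_gamma F pe pX).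
rewrite bracketE // (gammaB cov) //; last exact: (berwald_pi F).
rewrite fieldB berwald_gamma_eta // -[gamma eta]/C E1.
by generalize_values; lra.
Qed.

End CanonicalSpray.

(** * Projective change *)

Section Projective.
Context {R : realType} {n : nat} (M : manifold R n) (L L' lambda : TM M -> R).
Context (F : finsler_objects L) (F' : finsler_objects L').
Hypothesis hL : finsler L.
Hypothesis hlambda : projective_change F F' lambda.
Local Notation cov := (slit_cover F).
Local Notation gT := (gT cov).
Local Notation pvf := (@pi_vector_field R n M).
Local Notation vf := (vector_field (@smT R n M)).
Local Notation smoothT := (smooth (@smT R n M)).
Local Notation br := (bracket (@smT R n M)).
Local Notation lam := (restr lambda).
Local Notation alpha := (alpha F lambda).
Local Notation Q := (Qform F lambda).
Local Notation D2alpha := (D2form1 F alpha).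
Local Notation eps := (epsilon F lambda).
Local Notation G := (spray F).
Local Notation beta := (hmap F).
Local Notation K := (kmap F).
Local Notation D := (berwald F).
Local Notation beta' := (hmap F').
Local Notation K' := (kmap F').
Local Notation D' := (berwald F').
#[local] Existing Instance germ_filter.
Implicit Types (X Y Z W : pifield M) (A B : field R (slit M)).

Let hG : rho G = eta := spray_semispray hL F.
Let pe : pvf eta := @eta_pi _ _ M.
Let sG (A : pifield M) (pA : pvf A) := gamma_vf cov pA.

Lemma factor_smooth : smoothT lam. Proof. by case: hlambda. Qed.

Lemma liouville_factor u : gamma eta u lam = lam u.
Proof.
by have [sl hl _] := hlambda; exact: (liouville_homogeneous cov hl (sl u)).
Qed.

Lemma spray_projective : spray F' = G - (fun u => 2 * lam u) *v gamma eta.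
Proof. by case: hlambda. Qed.

Lemma semispray_projective : rho (spray F') = eta.
Proof.
rewrite spray_projective rhoB hG -[(fun u => _) *v gamma eta]addr0 rho_lin.
rewrite (rho_gamma cov) // rho0 addr0; apply: field_ext => u g.
by rewrite !fieldE mulr0 subr0.
Qed.
Let hG' := semispray_projective.

Lemma alphaE X : pvf X -> alpha X = act (gamma X) lam.
Proof. by move=> pX; rewrite /Defs.alpha /dJ /J rho_beta. Qed.

Lemma alpha_smooth X : pvf X -> smoothT (alpha X).
Proof. by move=> pX u; have sl := factor_smooth; rewrite alphaE //; exact: vf_act (sG pX) (sl u). Qed.

Lemma alphaD X Y u : pvf X -> pvf Y -> alpha (X + Y) u = alpha X u + alpha Y u.
Proof. by move=> pX pY; rewrite !alphaE ?(gammaD cov) //; exact: (pvfD cov). Qed.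

Lemma alphaN X u : pvf X -> alpha (- X) u = - alpha X u.
Proof. by move=> pX; rewrite !alphaE ?(gammaN cov) //; exact: (pvfN cov). Qed.

Lemma alphaZ f X u : smoothT f -> pvf X -> alpha (f *v X) u = f u * alpha X u.
Proof.
move=> Sf pX; have p0 := pvf0 cov; have pfX := pvf_scale cov Sf pX.
rewrite -[f *v X]addr0 alphaD // !alphaE // -[f *v X]addr0 (gamma_lin cov) //.
by rewrite (gamma0 cov) /act !fieldE !addr0.
Qed.

Lemma alpha_eta : alpha eta = lam.
Proof. by rewrite alphaE //; apply/funext => u; exact: liouville_factor. Qed.

Definition projective_shift X : pifield M := alpha X *v eta + lam *v X.
Local Notation T := projective_shift.

Lemma shift_pi X : pvf X -> pvf (T X).
Proof.
move=> pX; apply: (pvf_scaleD cov) => //; first exact: alpha_smooth.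
by apply: (pvf_scale cov) => //; exact: factor_smooth.
Qed.

(** In [connectorE] only G(u(g)) changes, by - 2 lambda u(g); half of its derivative along gamma(rho
    A) is, up to sign, T(rho A) evaluated on g. *)
Lemma connector_projective A : vf A -> K' A = K A + T (rho A).
Proof.
move=> vA; have pr := rho_pi cov vA; have pT := shift_pi pr; have vG := spray_vf F.
have sl := factor_smooth; have vr := sG pr.
apply: (pvf_ext (connector_pi F' vA) (pvfD cov (connector_pi F vA) pT)) => u g Sg.
have Sh : smT u (lift_fun g) := vec_smooth Sg; have SGh := vf_act vG Sh.
have Slh : smT u (fun v => lam v * lift_fun g v) by exact: (germ_mul gT).
have S2 : smT u (fun v => 2 * (lam v * lift_fun g v)) by exact: (germ_scale gT).
rewrite (connectorE hG') // !fieldE (connectorE hG) //.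
have -> : gamma (rho A) u (act (spray F') (lift_fun g)) =
    gamma (rho A) u (fun v => act G (lift_fun g) v - 2 * (lam v * lift_fun g v)).
  apply: esym; apply: (act_local (gS := gT) vr (germ_sub gT SGh S2)).
  apply: filterS (base_near cov Sg) => v Sgv.
  rewrite spray_projective [RHS]/act !fieldE (gamma_vec cov pe Sgv).
  by rewrite -[eta v g]/(lift_fun g v); generalize_values; ring.
have tr := vf_tangent u vr.
rewrite (tangent_sub gT tr SGh S2) (tangent_scale gT tr 2 Slh).
rewrite (tangent_mul tr (sl u) Sh) (gamma_vec cov pr Sg) /projective_shift !fieldE (alphaE pr).
rewrite -[act (gamma (rho A)) lam u]/(gamma (rho A) u lam) -[eta u g]/(lift_fun g u).
by generalize_values; field.
Qed.

(** Since K' kills beta' X, the previous formula for K' gives K(beta' X) = - T X, the vertical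
    component in the splitting defined by F. *)
Lemma hmap_projective X : pvf X -> beta' X = beta X - gamma (T X).
Proof.
move=> pX; have vb := beta_vf F' pX; have pT := shift_pi pX.
rewrite [LHS](horizontal_vertical hG) // (rho_beta F') //.
have := connector_projective vb; rewrite connector_beta // rho_beta // => E.
have -> : K (beta' X) = - T X by apply/eqP; rewrite -addr_eq0 -E.
by rewrite (gammaN cov) // addrC.
Qed.

Lemma berwald_gamma_projective X Y : pvf X -> pvf Y -> D' (gamma X) Y = D (gamma X) Y.
Proof.
move=> pX pY; have vX := sG pX.
apply: (pvf_ext (berwald_pi F' vX pY) (berwald_pi F vX pY)) => u g Sg.
by rewrite !berwald_gammaE.
Qed.

Lemma gamma_alphaB X Y u : pvf X -> pvf Y ->
  gamma X u (alpha Y) - gamma Y u (alpha X) =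
  alpha (D (gamma X) Y) u - alpha (D (gamma Y) X) u.
Proof.
move=> pX pY; have vX := sG pX; have vY := sG pY; have sl := factor_smooth.
have pXY := berwald_pi F vX pY; have pYX := berwald_pi F vY pX.
have := congr1 (fun A => A u lam) (bracket_gamma_gamma F pX pY).
by rewrite bracketE // (gammaB cov) // !alphaE.
Qed.

Lemma D2alphaC X Y u : pvf X -> pvf Y -> D2alpha X Y u = D2alpha Y X u.
Proof.
move=> pX pY; have := gamma_alphaB u pX pY.
by rewrite /D2form1 /act; generalize_values; lra.
Qed.

Lemma D2alpha_smooth X Y : pvf X -> pvf Y -> smoothT (D2alpha X Y).
Proof.
move=> pX pY u; have sY := alpha_smooth pY.
have sD := alpha_smooth (berwald_pi F (sG pX) pY).
by apply: (germ_sub gT); [exact: vf_act (sG pX) (sY u)|exact: sD].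
Qed.

Lemma D2alpha_linl f X W Y u : smoothT f -> pvf X -> pvf W -> pvf Y ->
  D2alpha (f *v X + W) Y u = f u * D2alpha X Y u + D2alpha W Y u.
Proof.
move=> Sf pX pW pY; have vX := sG pX; have vW := sG pW.
have pXY := berwald_pi F vX pY; have pWY := berwald_pi F vW pY.
have pfXY := pvf_scale cov Sf pXY.
rewrite /D2form1 (gamma_lin cov) // berwald_linl // alphaD // alphaZ // /act !fieldE.
by generalize_values; ring.
Qed.

Lemma D2alphaNl X Y u : pvf X -> pvf Y -> D2alpha (- X) Y u = - D2alpha X Y u.
Proof.
move=> pX pY; have vX := sG pX; have pXY := berwald_pi F vX pY.
rewrite /D2form1 (gammaN cov) // berwaldNl // alphaN // /act fieldN.
by generalize_values; ring.
Qed.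

Lemma D2alphaZl f X Y u : smoothT f -> pvf X -> pvf Y ->
  D2alpha (f *v X) Y u = f u * D2alpha X Y u.
Proof.
move=> Sf pX pY; have pN := pvfN cov pX.
have S1 : smoothT (fun v => f v + 1).
  by move=> v; apply: (germ_add gT); [exact: Sf | exact: (germ_cst gT)].
(* [D2alpha_linl] requires a second summand; [- X] is chosen because its contribution is already
   known from [D2alphaNl]. *)
have -> : f *v X = (fun v => f v + 1) *v X + - X.
  by apply: field_ext => v g; rewrite !fieldE; generalize_values; ring.
rewrite (D2alpha_linl u S1 pX pN pY).
rewrite (D2alphaNl u pX pY).
by generalize_values; ring.
Qed.

(** Homogeneity of degree 0 of alpha. By symmetry eta is moved to the second slot, where alpha(eta)
    = lambda and D_{gamma Y} eta = Y make the two terms equal. *)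
Lemma D2alpha_eta Y u : pvf Y -> D2alpha eta Y u = 0.
Proof.
move=> pY; rewrite D2alphaC // /D2form1 berwald_gamma_eta // alpha_eta alphaE //.
by rewrite subrr.
Qed.

Lemma D2alpha_shift X Y u : pvf X -> pvf Y -> D2alpha (T X) Y u = lam u * D2alpha X Y u.
Proof.
move=> pX pY; have sl := factor_smooth; have sX := alpha_smooth pX.
rewrite (D2alpha_linl u sX pe (pvf_scale cov sl pX) pY) (D2alpha_eta u pY).
by rewrite mulr0 add0r (D2alphaZl u sl pX pY).
Qed.

(** The vertical derivative (D_{gamma Y} T)(X), written out and made visibly symmetric in X and
    Y. *)
Definition berwald_difference X Y : pifield M :=
  D2alpha X Y *v eta + (alpha X *v Y + alpha Y *v X).
Local Notation B_ := berwald_difference.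

Lemma difference_pi X Y : pvf X -> pvf Y -> pvf (B_ X Y).
Proof.
move=> pX pY; apply: (pvf_scaleD cov) => //; first exact: D2alpha_smooth.
apply: (pvf_scaleD cov) => //; first exact: alpha_smooth.
by apply: (pvf_scale cov) => //; exact: alpha_smooth.
Qed.

Lemma differenceNl X Y : pvf X -> pvf Y -> B_ (- X) Y = - B_ X Y.
Proof.
move=> pX pY; apply: field_ext => u g; rewrite /berwald_difference !fieldE (D2alphaNl u pX pY) (alphaN u pX).
by generalize_values; ring.
Qed.

Lemma berwald_shift A Y : vf A -> pvf Y ->
  D A (T Y) = act A (alpha Y) *v eta + alpha Y *v D A eta + (act A lam *v Y + lam *v D A Y).
Proof.
move=> vA pY; have sl := factor_smooth; have sY := alpha_smooth pY.
rewrite /projective_shift berwaldDr //; try exact: (pvf_scale cov).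
by rewrite !berwaldZr.
Qed.

(** Compute K'[beta' X, gamma Y]. The part gamma(T X) of beta' X contributes D_{gamma Y} (T X), and
    T applied to rho of the bracket contributes - T(D_{gamma Y} X); together they are (D_{gamma Y}
    T)(X). *)
Lemma berwald_beta_projective X Y : pvf X -> pvf Y ->
  D' (beta' X) Y = D (beta' X) Y + B_ X Y.
Proof.
move=> pX pY; have vX := beta_vf F pX; have vY := sG pY; have pT := shift_pi pX.
have vT := sG pT; have pYX := berwald_pi F vY pX; have vb' := beta_vf F' pX.
have v1 := br_vf F vX vY; have v2 := br_vf F vT vY.
have pTY := berwald_pi F vT pY; have pYT := berwald_pi F vY pT.
rewrite berwald_beta // connector_projective; last exact: (br_vf F).
rewrite [X in T X](_ : _ = - D (gamma Y) X); last first.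
  by rewrite bracketC rhoN (rho_bracket_gammaE F) // rho_beta.
rewrite hmap_projective // (bracketBl gT) // (connectorB hG) // -berwald_beta //.
rewrite (bracket_gamma_gamma F) // (connector_gamma hG); last exact: (pvfB cov).
rewrite berwaldBl // berwald_shift // berwald_gamma_eta //.
apply: field_ext => u g; rewrite /projective_shift /berwald_difference !fieldE (alphaN u pYX).
rewrite (D2alphaC u pX pY) [alpha Y]alphaE // /D2form1.
by generalize_values; ring.
Qed.

(** The field is split by F', not by F: D and D' agree on its vertical part, and on the part
    beta'(rho A) the preceding lemma applies. *)
Lemma berwald_projective A Y : vf A -> pvf Y -> D' A Y = D A Y + B_ (rho A) Y.
Proof.
move=> vA pY; have pr := rho_pi cov vA; have pK := connector_pi F' vA.
have vK := sG pK; have vb := beta_vf F' pr.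
rewrite {1 2}(horizontal_vertical hG' vA) !berwaldDl //.
by rewrite berwald_gamma_projective // berwald_beta_projective // addrA.
Qed.

(** Commuting gamma X past beta Y on lambda turns vertical derivatives of Q into the horizontal
    derivative (D_{beta Y} alpha)(X). The other two terms are symmetric, so epsilon(X, Y) = (D_{beta
    Y} alpha)(X) - (D_{beta X} alpha)(Y), the form in which it appears in the torsion. *)
Lemma D2form1Q X Y u : pvf X -> pvf Y -> D2form1 F Q X Y u =
  beta Y u (alpha X) - alpha (D (beta Y) X) u - alpha X u * alpha Y u - lam u * D2alpha X Y u.
Proof.
move=> pX pY; have vX := sG pX; have vY := beta_vf F pY; have sl := factor_smooth.
have pXY := berwald_pi F vX pY; have pYX := berwald_pi F vY pX; have sY := alpha_smooth pY.
have vgYX := sG pYX; have vbXY := beta_vf F pXY; have tX := vf_tangent u vX.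
have Sb : smT u (act (beta Y) lam) by exact: vf_act vY (sl u).
have SlY : smT u (fun v => lam v * alpha Y v) by exact: (germ_mul gT).
have := congr1 (fun A => A u lam) (bracket_beta_gamma hG pY pX).
rewrite bracketE // fieldB -[gamma _ u lam]/(act (gamma (D (beta Y) X)) lam u).
rewrite -(alphaE pYX) -(alphaE pX).
have -> : D2form1 F Q X Y u = gamma X u (Q Y) - Q (D (gamma X) Y) u by [].
have -> : gamma X u (Q Y) = gamma X u (act (beta Y) lam) -
    (lam u * gamma X u (alpha Y) + alpha Y u * alpha X u).
  rewrite (alphaE pX) -[act (gamma X) lam u]/(gamma X u lam).
  by rewrite -(tangent_mul tX) // -(tangent_sub gT tX).
have -> : Q (D (gamma X) Y) u = beta (D (gamma X) Y) u lam - lam u * alpha (D (gamma X) Y) u by [].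
have -> : D2alpha X Y u = gamma X u (alpha Y) - alpha (D (gamma X) Y) u by [].
by generalize_values; nra.
Qed.

Lemma Q_smooth X : pvf X -> smoothT (Q X).
Proof.
move=> pX u; have sl := factor_smooth; have sX := alpha_smooth pX.
apply: (germ_sub gT); first exact: vf_act (beta_vf F pX) (sl u).
by apply: (germ_mul gT).
Qed.

Lemma epsilon_smooth X Y : pvf X -> pvf Y -> smoothT (eps X Y).
Proof.
have sD V W : pvf V -> pvf W -> smoothT (D2form1 F Q V W).
  move=> pV pW u; have sQ := Q_smooth pW; have sQ' := Q_smooth (berwald_pi F (sG pV) pW).
  by apply: (germ_sub gT); [exact: vf_act (sG pV) (sQ u)|exact: sQ'].
move=> pX pY u; have s1 := sD _ _ pX pY; have s2 := sD _ _ pY pX.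
by apply: (germ_sub gT); [exact: s1|exact: s2].
Qed.

(** Both components of [beta X - gamma(T X), beta Y - gamma(T Y)] are computed with the connection
    of F, and K' = K + T rho is applied to them. *)
Lemma horizontal_torsion_projective X Y : pvf X -> pvf Y ->
  horizontal_torsion F' X Y =
  horizontal_torsion F X Y + eps X Y *v eta - Q X *v Y + Q Y *v X.
Proof.
move=> pX pY; have vX := beta_vf F pX; have vY := beta_vf F pY.
have pTX := shift_pi pX; have pTY := shift_pi pY; have vTX := sG pTX; have vTY := sG pTY.
have vX' := beta_vf F' pX; have vY' := beta_vf F' pY.
have v1 := br_vf F vX vY; have v2 := br_vf F vX vTY; have v3 := br_vf F vTX vY.
have v4 := br_vf F vTX vTY; have v5 := br_vf F vY vTX.
have pXY := berwald_pi F vX pY; have pYX := berwald_pi F vY pX.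
have pXTY := berwald_pi F vX pTY; have pYTX := berwald_pi F vY pTX.
have pTXY := berwald_pi F vTX pY; have pTYX := berwald_pi F vTY pX.
have pTXTY := berwald_pi F vTX pTY; have pTYTX := berwald_pi F vTY pTX.
have brE : br (beta' X) (beta' Y) = br (beta X) (beta Y) - br (beta X) (gamma (T Y))
    + br (beta Y) (gamma (T X)) + br (gamma (T X)) (gamma (T Y)).
  rewrite !hmap_projective // (bracketBl gT) //; last exact: (vfB gT).
  rewrite !(bracketBr gT) // [br (gamma (T X)) (beta Y)]bracketC.
  by apply: field_ext => u g; rewrite !fieldE; generalize_values; ring.
have vB := vfB gT v1 v2; have vB' := vfD gT vB v5.
have KE : K (br (beta' X) (beta' Y)) = horizontal_torsion F X Y - D (beta X) (T Y)
    + D (beta Y) (T X) + (D (gamma (T X)) (T Y) - D (gamma (T Y)) (T X)).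
  rewrite brE connectorD // connectorD // connectorB // -!berwald_beta //.
  by rewrite (bracket_gamma_gamma F) // (connector_gamma hG) //; exact: (pvfB cov).
have rE : rho (br (beta' X) (beta' Y)) = D (beta X) Y - D (beta Y) X
    + D (gamma (T Y)) X - D (gamma (T X)) Y.
  rewrite brE !rhoD rhoN (torsion_free hG) // (bracket_gamma_gamma F) // (rho_gamma cov).
    rewrite [br (beta X) _]bracketC [br (beta Y) _]bracketC !rhoN.
    by rewrite !(rho_bracket_gammaE F) // !rho_beta // opprK addr0.
  exact: (pvfB cov).
have p1 := pvfB cov pXY pYX; have p2 := pvfD cov p1 pTYX.
(* Here the homogeneity of the spray enters: otherwise D_{beta X} (T Y) would leave the terms
   alpha(Y) D_{beta X} eta. *)
have beta_eta W : pvf W -> D (beta W) eta = 0 by exact: berwald_beta_eta.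
have aE u : alpha (D (beta X) Y - D (beta Y) X + D (gamma (T Y)) X - D (gamma (T X)) Y) u =
    alpha (D (beta X) Y) u - alpha (D (beta Y) X) u + alpha (D (gamma (T Y)) X) u
    - alpha (D (gamma (T X)) Y) u.
  rewrite alphaD //; last exact: (pvfN cov).
  rewrite alphaN // alphaD // alphaD //; last exact: (pvfN cov).
  by rewrite alphaN.
rewrite /horizontal_torsion connector_projective; last exact: (br_vf F).
rewrite -/(horizontal_torsion F X Y) KE rE !berwald_shift // !beta_eta // !berwald_gamma_eta //.
apply: field_ext => u g; rewrite /projective_shift !fieldE aE.
(* The terms quadratic in lambda come from derivatives along gamma(T W). [lamT] and [alphaT]
   evaluate them by Euler's relation, and their symmetric contributions cancel or join the products
   lambda alpha inside Q. *)
have lamT W : pvf W -> gamma (T W) u lam = 2 * lam u * alpha W u.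
  move=> pW; have sl := factor_smooth; have sW := alpha_smooth pW.
  rewrite -[LHS]/(act (gamma (T W)) lam u) -(alphaE (shift_pi pW)).
  rewrite alphaD ?alphaZ // ?alpha_eta; try exact: (pvf_scale cov).
  by generalize_values; ring.
have alphaT V W : pvf V -> pvf W ->
    gamma (T V) u (alpha W) = alpha (D (gamma (T V)) W) u + lam u * D2alpha V W u.
  move=> pV pW; have := D2alpha_shift u pV pW.
  rewrite -[D2alpha (T V) W u]/(gamma (T V) u (alpha W) - alpha (D (gamma (T V)) W) u).
  by generalize_values; lra.
have epsE : eps X Y u = D2form1 F Q X Y u - D2form1 F Q Y X u by [].
have QE W : Q W u = beta W u lam - lam u * alpha W u by [].
rewrite epsE !D2form1Q // !QE (D2alphaC u pY pX).
have := lamT X pX; have := lamT Y pY; have := alphaT X Y pX pY; have := alphaT Y X pY pX.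
rewrite (D2alphaC u pY pX) /act => -> -> -> ->.
by generalize_values; ring.
Qed.

End Projective.

(** * The change of the two curvature tensors *)

Section ProjectiveCurvature.
Context {R : realType} {n : nat} (M : manifold R n) (L L' lambda : TM M -> R).
Context (F : finsler_objects L) (F' : finsler_objects L').
Hypothesis hL : finsler L.
Hypothesis hlambda : projective_change F F' lambda.
Local Notation cov := (slit_cover F).
Local Notation gT := (gT cov).
Local Notation pvf := (@pi_vector_field R n M).
Local Notation vf := (vector_field (@smT R n M)).
Local Notation smoothT := (smooth (@smT R n M)).
Local Notation br := (bracket (@smT R n M)).
Local Notation lam := (restr lambda).
Local Notation alpha := (alpha F lambda).
Local Notation Q := (Qform F lambda).
Local Notation D2alpha := (D2form1 F alpha).
Local Notation eps := (epsilon F lambda).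
Local Notation G := (spray F).
Local Notation D := (berwald F).
Local Notation beta' := (hmap F').
Implicit Types (X Y Z W : pifield M) (A B : field R (slit M)).

Let hG : rho G = eta := spray_semispray hL F.
Let pe : pvf eta := @eta_pi _ _ M.
Let sG (A : pifield M) (pA : pvf A) := gamma_vf cov pA.
Let hG' : rho (spray F') = eta := semispray_projective hL hlambda.
Local Notation B_ := (berwald_difference lambda F).

(** Vertical differentiation of the torsion formula. The identity tensor is constant for it, so only
    Q and epsilon get differentiated, except that D_{gamma Z} eta = Z yields the additional term
    epsilon(X, Y) Z. *)
Lemma hcurv_projective X Y Z : pvf X -> pvf Y -> pvf Z ->
  hcurv F' X Y Z =
    hcurv F X Y Z
    + D2form1 F Q Z Y *v X - D2form1 F Q Z X *v Y
    + eps X Y *v Z + D2form2 F eps Z X Y *v eta.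
Proof.
move=> pX pY pZ; have vZ := sG pZ.
have pZX := berwald_pi F vZ pX; have pZY := berwald_pi F vZ pY.
have sQX := Q_smooth hlambda pX; have sQY := Q_smooth hlambda pY.
have sE := epsilon_smooth hlambda pX pY; have pO := horizontal_torsion_pi F pX pY.
have pEe := pvf_scale cov sE pe; have pQX := pvf_scale cov sQX pY.
have pQY := pvf_scale cov sQY pX.
have p1 := pvfD cov pO pEe; have p2 := pvfB cov p1 pQX.
have torsionE V W (pV : pvf V) (pW : pvf W) := horizontal_torsion_projective hL hlambda pV pW.
have p' : pvf (horizontal_torsion F' X Y) by exact: horizontal_torsion_pi.
rewrite (hcurvE hG') // (hcurvE hG) // !(berwald_gamma_projective F F') // !torsionE //.
rewrite (berwaldDr F vZ p2 pQY) (berwaldBr F vZ p1 pQX) (berwaldDr F vZ pO pEe).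
rewrite (berwaldZr F sE vZ pe) (berwaldZr F sQX vZ pY) (berwaldZr F sQY vZ pX).
rewrite berwald_gamma_eta //; apply: field_ext => u g; rewrite !fieldE.
have -> : D2form1 F Q Z Y u = gamma Z u (Q Y) - Q (D (gamma Z) Y) u by [].
have -> : D2form1 F Q Z X u = gamma Z u (Q X) - Q (D (gamma Z) X) u by [].
have -> : D2form2 F eps Z X Y u = gamma Z u (eps X Y) - eps (D (gamma Z) X) Y u
    - eps X (D (gamma Z) Y) u by [].
by generalize_values; ring.
Qed.

(** Symmetry of third vertical derivatives. The expansion of P' produces gamma Y as the outer
    direction, whereas the formula sought has X first. The second-order terms are exchanged by the
    vanishing of the vertical curvature, the derivatives of alpha(Z) by the bracket of two lifts. *)
Lemma D3alphaC X Y Z u : pvf X -> pvf Y -> pvf Z ->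
  D2form2 F D2alpha X Y Z u = D2form2 F D2alpha Y X Z u.
Proof.
move=> pX pY pZ; have vX := sG pX; have vY := sG pY.
have pXY := berwald_pi F vX pY; have pYX := berwald_pi F vY pX.
have pXZ := berwald_pi F vX pZ; have pYZ := berwald_pi F vY pZ.
have pXYZ := berwald_pi F vX pYZ; have pYXZ := berwald_pi F vY pXZ.
have vXY := sG pXY; have vYX := sG pYX.
have pXYZ' := berwald_pi F vXY pZ; have pYXZ' := berwald_pi F vYX pZ.
have sZ := alpha_smooth hlambda pZ; have vB := br_vf F vX vY.
have E2 : alpha (D (gamma X) (D (gamma Y) Z)) u - alpha (D (gamma Y) (D (gamma X) Z)) u =
    alpha (D (gamma (D (gamma X) Y)) Z) u - alpha (D (gamma (D (gamma Y) X)) Z) u.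
  have pN := pvfN cov pXYZ; have pN' := pvfN cov pYXZ'.
  have p1 := pvfD cov pN pYXZ; have p2 := pvfD cov pXYZ' pN'.
  have := vertical_curvature0 F pX pY pZ; rewrite /curvature (bracket_gamma_gamma F pX pY).
  rewrite (gammaB cov pXY pYX) (berwaldBl F vXY vYX pZ) => E3.
  have : alpha (- D (gamma X) (D (gamma Y) Z) + D (gamma Y) (D (gamma X) Z) +
     (D (gamma (D (gamma X) Y)) Z - D (gamma (D (gamma Y) X)) Z)) u = 0.
    by rewrite E3 (alphaE lambda F (pvf0 cov)) (gamma0 cov).
  rewrite (alphaD lambda F u p1 p2) (alphaD lambda F u pN pYXZ) (alphaD lambda F u pXYZ' pN').
  rewrite (alphaN lambda F u pXYZ) (alphaN lambda F u pYXZ').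
  by generalize_values; lra.
have := congr1 (fun A => A u (alpha Z)) (bracket_gamma_gamma F pX pY).
rewrite (bracketE _ _ (sZ u)).
rewrite (gammaB cov pXY pYX).
rewrite fieldB => E1.
have D2E V W : pvf V -> pvf W -> smoothT (alpha W) -> smoothT (alpha (D (gamma V) W)) ->
    forall A, vf A -> A u (D2alpha V W) =
    A u (act (gamma V) (alpha W)) - A u (alpha (D (gamma V) W)).
  move=> pV pW sW sVW A vA.
  by rewrite -(tangent_sub gT (vf_tangent u vA) (vf_act (sG pV) (sW u)) (sVW u)).
have sXZ := alpha_smooth hlambda pXZ; have sYZ := alpha_smooth hlambda pYZ.
have EX := D2E Y Z pY pZ sZ sYZ _ vX; have EY := D2E X Z pX pZ sZ sXZ _ vY.
have d2 V W : D2alpha V W u = gamma V u (alpha W) - alpha (D (gamma V) W) u by [].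
have -> : D2form2 F D2alpha X Y Z u = gamma X u (D2alpha Y Z) - D2alpha (D (gamma X) Y) Z u
    - D2alpha Y (D (gamma X) Z) u by [].
have -> : D2form2 F D2alpha Y X Z u = gamma Y u (D2alpha X Z) - D2alpha (D (gamma Y) X) Z u
    - D2alpha X (D (gamma Y) Z) u by [].
rewrite EX EY !d2; move: E1 E2; clear; generalize_values; lra.
Qed.

(** With D' = D + B(rho), the three curvature terms contribute - B(X, D_{gamma Y} Z), D_{gamma Y}
    (B(X, Z)) and - B(D_{gamma Y} X, Z), which is (D_{gamma Y} B)(X, Z). *)
Lemma hvcurv_projective X Y Z : pvf X -> pvf Y -> pvf Z ->
  hvcurv F' X Y Z =
    hvcurv F X Y Z
    + (D2alpha Y Z *v X + D2alpha Z X *v Y + D2alpha X Y *v Z)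
    + D2form2 F D2alpha X Y Z *v eta.
Proof.
move=> pX pY pZ; have vY := sG pY; have vX := beta_vf F pX; have vX' := beta_vf F' pX.
have pT := shift_pi hlambda pX; have vT := sG pT.
have pYX := berwald_pi F vY pX; have pYZ := berwald_pi F vY pZ.
have pXZ := berwald_pi F vX pZ; have pTZ := berwald_pi F vT pZ.
have pXZ' := berwald_pi F vX' pZ; have pB := difference_pi hlambda pX pZ.
have v1 := br_vf F vX vY; have v2 := br_vf F vT vY; have v' := br_vf F vX' vY.
have pD' := pvfD cov pXZ' pB.
have sX := alpha_smooth hlambda pX; have sZ := alpha_smooth hlambda pZ.
have sXZ := D2alpha_smooth hlambda pX pZ.
have q1 := pvf_scale cov sXZ pe; have q2 := pvf_scale cov sX pZ; have q3 := pvf_scale cov sZ pX.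
have rE : rho (br (beta' X) (gamma Y)) = - D (gamma Y) X.
  by rewrite bracketC rhoN (rho_bracket_gammaE F) // rho_beta.
rewrite /hvcurv /curvature (berwald_gamma_projective F F') //.
rewrite !(berwald_beta_projective hL hlambda) // (berwald_gamma_projective F F') //.
rewrite (berwald_projective hL hlambda v') // rE (differenceNl lambda F pYX pZ).
rewrite (berwaldDr F vY pXZ' pB) (hmap_projective hL hlambda pX) !(berwaldBl F vX vT) //.
rewrite (berwaldBr F vY pXZ pTZ) (bracketBl gT) // (berwaldBl F v1 v2) //.
(* The part - gamma(T X) of beta' X contributes a curvature of two vertical fields, which is
   zero. *)
have := vertical_curvature0 F pT pY pZ; rewrite /curvature => V0.
have BE : D (gamma Y) (B_ X Z) = act (gamma Y) (D2alpha X Z) *v eta + D2alpha X Z *v Y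
    + (act (gamma Y) (alpha X) *v Z + alpha X *v D (gamma Y) Z
    + (act (gamma Y) (alpha Z) *v X + alpha Z *v D (gamma Y) X)).
  rewrite /berwald_difference (berwaldDr F vY q1 (pvfD cov q2 q3)) (berwaldDr F vY q2 q3).
  rewrite (berwaldZr F sXZ vY pe) (berwaldZr F sX vY pZ) (berwaldZr F sZ vY pX).
  by rewrite berwald_gamma_eta.
rewrite BE; apply: field_ext => u g; have := congr1 (fun W : pifield M => W u g) V0.
rewrite /berwald_difference !fieldE (D3alphaC u pX pY pZ) (D2alphaC hlambda u pZ pX).
rewrite (D2alphaC hlambda u pX pY).
have -> : D2alpha Y X u = gamma Y u (alpha X) - alpha (D (gamma Y) X) u by [].
have -> : D2alpha Y Z u = gamma Y u (alpha Z) - alpha (D (gamma Y) Z) u by [].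
have -> : D2form2 F D2alpha Y X Z u = gamma Y u (D2alpha X Z) - D2alpha (D (gamma Y) X) Z u
    - D2alpha X (D (gamma Y) Z) u by [].
by generalize_values; nra.
Qed.

End ProjectiveCurvature.

Theorem theorem2p11 (R : realType) (n : nat) (M : manifold R n)
    (L L' lambda : TM M -> R)
    (hL : finsler L) (hL' : finsler L')
    (F : finsler_objects L) (F' : finsler_objects L')
    (hlambda : projective_change F F' lambda)
    (X Y Z : pifield M)
    (hX : pi_vector_field X) (hY : pi_vector_field Y)
    (hZ : pi_vector_field Z) :
  hcurv F' X Y Z =
    hcurv F X Y Z
    + D2form1 F (Qform F lambda) Z Y *v X
    - D2form1 F (Qform F lambda) Z X *v Y
    + epsilon F lambda X Y *v Z
    + D2form2 F (epsilon F lambda) Z X Y *v eta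
  /\
  hvcurv F' X Y Z =
    hvcurv F X Y Z
    + (D2form1 F (alpha F lambda) Y Z *v X
       + D2form1 F (alpha F lambda) Z X *v Y
       + D2form1 F (alpha F lambda) X Y *v Z)
    + D2form2 F (D2form1 F (alpha F lambda)) X Y Z *v eta.
Proof.
split; first exact: (hcurv_projective hL hlambda hX hY hZ).
exact: (hvcurv_projective hL hlambda hX hY hZ).
Qed.
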